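(* Let $p\ge2$ and let $h$ satisfy $\lim_{t\to\infty}\frac{h'(t)}{t^{p-1}h(t)}=0$. Let $\{(\lambda_n,\mu_n,u_n)\}$ be a sequence of solutions (in the sense of the context) with $\mu_n\to\infty$ and $\lambda_n\to\lambda_*$ for some $\lambda_*\in[0,\infty]$ as $n\to\infty$. Then one of the following (i), (ii), (iii) occurs, up to a subsequence. (i) $\lambda_*=0$ and $u_n\to0$ in $C^2_{\mathrm{loc}}((0,1])$. (ii) $\lambda_*\in(0,\infty)$ and there exists a smooth nonincreasing function $u_*$ on $(0,1]$ such that $u_n\to u_*$ in $C^2_{\mathrm{loc}}((0,1])$. Furthermore, $(\lambda_*,u_* )$ satisfies $-u_*''-\frac1ru_*'=\lambda_*f(u_* )$, $u_*\ge0$ in $(0,1)$, $u_*(1)=0$, and $\int_0^1\lambda_*f(u_* )\,r\,dr<\infty$. Moreover, if $f(0)>0$, then $u_*>0$ in $(0,1)$. (iii) $\lambda_*=\infty$ and $(u_n)$ is uniformly bounded in $C_{\mathrm{loc}}((0,1])$ (i.e. uniformly bounded on each compact subset of $(0,1]$). In addition, if $\inf_{t>0}(f(t)/t)>0$, then (iii) does not happen.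
   Context: $h:[0,\infty)\to\mathbb{R}$ is a nonnegative $C^1$ function and there is $t_0>0$ with $h(t)>0$ for all $t\ge t_0$; $f(t)=h(t)e^{t^p}$. A sequence of solutions $\{(\lambda_n,\mu_n,u_n)\}$ means: for every $n\in\mathbb N$, $\lambda_n>0$, $\mu_n>0$, and $u_n$ is a classical solution on $[0,1]$ of $-u_n''-\frac1r u_n'=\lambda_nf(u_n)$, $u_n>0$ in $(0,1)$, $u_n(0)=\mu_n$, $u_n'(0)=0=u_n(1)$. ''Up to a subsequence'' means after passing to a subsequence in $n$, not relabelled. ''Smooth'' means at least $C^2$ (a classical solution of the equation). *)

(* Defs.v *)
From Stdlib Require Import Reals.
From Coquelicot Require Import Coquelicot.
Open Scope R_scope.

Definition Icc01 (r : R) : Prop := 0 <= r <= 1.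
Definition Ioc01 (r : R) : Prop := 0 < r <= 1.
Definition Ici0 (t : R) : Prop := 0 <= t.

(* Stdlib's [Rpower 0 p] is 1, whereas [0 ^ p] must be 0 for [p > 0]. *)
Definition rpow (t p : R) : R := if Rlt_dec 0 t then Rpower t p else 0.

Definition nonlin (h : R -> R) (p t : R) : R := h t * exp (rpow t p).

(* Derivatives and continuity are relative to [D], hence one-sided at those
   endpoints of an interval [D] that belong to it. *)
Definition is_C1_on (D : R -> Prop) (u du : R -> R) : Prop :=
  forall x, D x -> D_in u du D x /\ continue_in du D x.

Definition is_C2_on (D : R -> Prop) (u du ddu : R -> R) : Prop :=
  forall x, D x -> D_in u du D x /\ D_in du ddu D x /\ continue_in ddu D x.

(* The equation is required on (0,1], its coefficient 1/r being singular at 0. *)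
Definition is_solution (f : R -> R) (lam mu : R) (u : R -> R) : Prop :=
  0 < lam /\ 0 < mu /\
  exists du ddu : R -> R,
    is_C2_on Icc01 u du ddu /\
    (forall r, Ioc01 r -> - ddu r - / r * du r = lam * f (u r)) /\
    (forall r, 0 < r < 1 -> 0 < u r) /\
    u 0 = mu /\ du 0 = 0 /\ u 1 = 0.

Definition unif_cv_on (K : R -> Prop) (v : nat -> R -> R) (w : R -> R) : Prop :=
  forall eps, 0 < eps ->
    exists N : nat, forall n, (N <= n)%nat ->
      forall x, K x -> Rabs (v n x - w x) < eps.

Definition C2loc_cv (D : R -> Prop) (v : nat -> R -> R) (w : R -> R) : Prop :=
  exists (dv ddv : nat -> R -> R) (dw ddw : R -> R),
    (forall n, is_C2_on D (v n) (dv n) (ddv n)) /\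
    is_C2_on D w dw ddw /\
    forall K, compact K -> included K D ->
      unif_cv_on K v w /\ unif_cv_on K dv dw /\ unif_cv_on K ddv ddw.

Definition loc_unif_bounded (D : R -> Prop) (v : nat -> R -> R) : Prop :=
  forall K, compact K -> included K D ->
    exists M, forall n x, K x -> Rabs (v n x) <= M.

Definition extraction (phi : nat -> nat) : Prop :=
  forall n, (phi n < phi (S n))%nat.

(* Main.v *)
Require Import Defs.
From Stdlib Require Import Reals Lra Psatz Lia IndefiniteDescription.
From Coquelicot Require Import Coquelicot.
Open Scope R_scope.

(** Let E(r) = - r u'(r), which increases with derivative lam f(u) r. Since
    f'/f tends to infinity, the primitive F of f satisfies F <= eps f + C_eps, and
    the Pohozaev identity gives E(1)^2 / 2 <= 2 eps E(1) + C_eps lam. So E(1) is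
    bounded when lam is, and tends to 0 with lam; moreover u <= E(1) log(1/r).
    As u_n(1) = 0 and f is locally Lipschitz, a subsequence along which u_n'(1)
    converges already makes u_n Cauchy in C^2 on each [d,1], by Gronwall's
    inequality run backwards from r = 1.
    If u(a) lies where f(t) >= K t, comparing E(a) <= u(a) / log(1/a) with the
    growth of E on [a/2,a] bounds lam in terms of K and a. Hence u_n(a) stays
    bounded if lam_n tends to infinity, and lam_n cannot do so if f(t) >= K t for
    all t > 0. *)

(** The obstacle is that u_n(0) tends to infinity, so no estimate may depend on the size of u near r
    = 0. The Pohozaev identity meets this demand, because E and r^2 F(u) both vanish at 0 and u
    vanishes at 1: only E(1) = - u'(1) survives. A single eps gives boundedness of E(1); its decay
    needs every eps, with eps fixed before lam is made small. Away from 0 the equation is regular,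
    and u solves a Cauchy problem posed at r = 1 with data u(1) = 0 and u'(1). The two numbers u'(1)
    and lam therefore control u on [d,1], so that compactness reduces to Bolzano-Weierstrass for a
    real sequence, and Gronwall even yields a rate of convergence. Integrability of the limit near 0
    is read off the flux of the limit: it is monotone and nonnegative, and its increments are the
    integrals in question. *)

(** * Mean value tools and one-sided derivatives *)

Lemma is_derive_continuity_pt (g : R -> R) (x l : R) :
  is_derive g x l -> continuity_pt g x.
Proof.
intros H; apply derivable_continuous_pt; exists l.
now apply is_derive_Reals.
Qed.

(** Differentiability is asked only inside the interval: the flux at r = 0 and the power [rpow] at t
    = 0 are handled through continuity alone. *)
Lemma MVT_open (g dg : R -> R) (a b : R) :
  a < b ->
  (forall x, a <= x <= b -> continuity_pt g x) ->
  (forall x, a < x < b -> is_derive g x (dg x)) ->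
  exists c, a < c < b /\ g b - g a = dg c * (b - a).
Proof.
intros ab gc gd.
assert (pr1 : forall c, a < c < b -> derivable_pt g c).
{ intros c Hc; exists (dg c); apply is_derive_Reals; auto. }
assert (pr2 : forall c, a < c < b -> derivable_pt id c).
{ intros c _; apply derivable_pt_id. }
destruct (MVT g id a b pr1 pr2 ab gc) as [c [P E]].
{ intros c _; apply derivable_continuous, derivable_id. }
exists c; split; [exact P|].
assert (E1 : derive_pt g c (pr1 c P) = dg c).
{ apply derive_pt_eq_0, is_derive_Reals; auto. }
assert (E2 : derive_pt id c (pr2 c P) = 1).
{ apply derive_pt_eq_0, derivable_pt_lim_id. }
rewrite E1, E2 in E; unfold id in E; lra.
Qed.

Lemma derive_ge0_le (g dg : R -> R) (a b : R) :
  a <= b ->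
  (forall x, a <= x <= b -> continuity_pt g x) ->
  (forall x, a < x < b -> is_derive g x (dg x)) ->
  (forall x, a < x < b -> 0 <= dg x) ->
  g a <= g b.
Proof.
intros [ab| ->] gc gd d0; [|lra].
destruct (MVT_open g dg a b ab gc gd) as [c [Hc E]].
specialize (d0 c Hc); nra.
Qed.

(* Past an endpoint, continue along the tangent line. *)
Lemma derivable_extension (g dg : R -> R) (a b : R) :
  a < b ->
  (forall x, a <= x <= b -> D_in g dg (fun y => a <= y <= b) x) ->
  exists G : R -> R, forall x, a <= x <= b -> G x = g x /\ is_derive G x (dg x).
Proof.
intros ab Hg.
set (m := fun x => Rmax a (Rmin x b)).
assert (m_in : forall x, a <= x <= b -> m x = x).
{ intros x Hx; unfold m; rewrite Rmin_left, Rmax_right; lra. }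
assert (m_r : forall x, b <= x -> m x = b).
{ intros x Hx; unfold m; rewrite Rmin_right, Rmax_right; lra. }
assert (m_l : forall x, x <= a -> m x = a).
{ intros x Hx; unfold m; rewrite Rmin_left, Rmax_left; lra. }
exists (fun x => g (m x) + dg (m x) * (x - m x)); intros x Hx.
split; [rewrite m_in by easy; ring|].
apply is_derive_Reals; intros eps Heps.
destruct (Hg x Hx eps Heps) as [alp [Halp H]].
(* A step shorter than [er] and [el] leaves [a,b] only if x is itself the endpoint crossed. The
   difference quotient is then exactly [dg x], so the value 1 chosen at an endpoint is arbitrary. *)
set (er := if Req_EM_T x b then 1 else b - x).
set (el := if Req_EM_T x a then 1 else x - a).
assert (Her : 0 < er) 
  by (unfold er; destruct (Req_EM_T x b), Hx as [_ [|]]; lra || congruence).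
assert (Hel : 0 < el) 
  by (unfold el; destruct (Req_EM_T x a), Hx as [[|] _]; lra || congruence).
assert (Hd : 0 < Rmin alp (Rmin er el)) by (repeat apply Rmin_glb_lt; lra).
exists (mkposreal _ Hd); intros k k0 Hk; simpl in Hk.
assert (Hk1 : Rabs k < alp) by (eapply Rlt_le_trans; [exact Hk|apply Rmin_l]).
assert (Hk2 : Rabs k < er).
{ eapply Rlt_le_trans; [exact Hk|].
  eapply Rle_trans; [apply Rmin_r|apply Rmin_l]. }
assert (Hk3 : Rabs k < el).
{ eapply Rlt_le_trans; [exact Hk|].
  eapply Rle_trans; [apply Rmin_r|apply Rmin_r]. }
apply Rabs_def2 in Hk2; apply Rabs_def2 in Hk3.
rewrite (m_in x Hx).
destruct (Rle_lt_dec (x + k) b) as [H1|H1];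
  [destruct (Rle_lt_dec a (x + k)) as [H2|H2]|].
- rewrite m_in by lra.
  specialize (H (x + k)); simpl in H; unfold Rdist in H.
  replace (x + k - x) with k in H by ring.
  replace (g (x + k) + dg (x + k) * (x + k - (x + k)) -
           (g x + dg x * (x - x))) with (g (x + k) - g x) by ring.
  apply H; repeat split; lra.
- rewrite m_l by lra.
  unfold el in Hk3; destruct (Req_EM_T x a) as [->|]; [|lra].
  replace ((g a + dg a * (a + k - a) - (g a + dg a * (a - a))) / k - dg a)
    with 0 by (field; lra).
  rewrite Rabs_R0; lra.
- rewrite m_r by lra.
  unfold er in Hk2; destruct (Req_EM_T x b) as [->|]; [|lra].
  replace ((g b + dg b * (b + k - b) - (g b + dg b * (b - b))) / k - dg b)
    with 0 by (field; lra).
  rewrite Rabs_R0; lra.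
Qed.

(** * Lipschitz functions on bounded intervals *)

Definition lipschitz_between (a b : R) (f : R -> R) (L : R) : Prop :=
  forall x y, a <= x <= b -> a <= y <= b -> Rabs (f x - f y) <= L * Rabs (x - y).

(** Only the half-line t >= 0 is covered: solutions are nonnegative and [h] is given no regularity
    for t < 0. *)
Definition loc_lipschitz (f : R -> R) : Prop :=
  forall M, exists L, 0 <= L /\ lipschitz_between 0 M f L.

Lemma lipschitz_derive (g dg : R -> R) (a b L : R) :
  (forall x, a <= x <= b -> continuity_pt g x) ->
  (forall x, a < x < b -> is_derive g x (dg x)) ->
  (forall x, a < x < b -> Rabs (dg x) <= L) ->
  lipschitz_between a b g L.
Proof.
intros gc gd gL.
assert (key : forall x y, a <= x <= b -> a <= y <= b -> x < y ->
          Rabs (g x - g y) <= L * Rabs (x - y)).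
{ intros x y Hx Hy xy.
  destruct (MVT_open g dg x y xy) as [c [Hc E]].
  - intros z Hz; apply gc; lra.
  - intros z Hz; apply gd; lra.
  - rewrite (Rabs_minus_sym (g x)), E, Rabs_mult, (Rabs_minus_sym x).
    apply Rmult_le_compat_r; [apply Rabs_pos|apply gL; lra]. }
intros x y Hx Hy; destruct (Rtotal_order x y) as [H|[->|H]].
- now apply key.
- rewrite !Rminus_diag, Rabs_R0; lra.
- rewrite (Rabs_minus_sym (g x)), (Rabs_minus_sym x); now apply key.
Qed.

(** Clamping by [Rmax 0] discards the values of [f] at negative t, which are arbitrary and could
    spoil continuity at 0. *)
Lemma loc_lipschitz_continuous (f : R -> R) :
  loc_lipschitz f -> continuity (fun t => f (Rmax 0 t)).
Proof.
intros Hf x eps Heps.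
destruct (Hf (Rabs x + 1)) as [L [L0 HL]].
(* [L + 1] because [L] may be 0. *)
assert (Hd : 0 < eps / (L + 1)) by (apply Rdiv_lt_0_compat; lra).
exists (Rmin 1 (eps / (L + 1))); split; [apply Rmin_glb_lt; lra|].
intros y [_ Hy]; simpl in *; unfold Rdist in *.
assert (Hy1 : Rabs (y - x) < 1) by (eapply Rlt_le_trans; [exact Hy|apply Rmin_l]).
assert (Hy2 : Rabs (y - x) < eps / (L + 1))
  by (eapply Rlt_le_trans; [exact Hy|apply Rmin_r]).
assert (Hx0 := Rabs_pos x).
assert (Hx1 := Rle_abs x).
apply Rabs_def2 in Hy1.
assert (Hm : Rabs (Rmax 0 y - Rmax 0 x) <= Rabs (y - x)).
{ unfold Rmax; destruct (Rle_dec 0 y), (Rle_dec 0 x);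
    split_Rabs; lra. }
assert (H : Rabs (f (Rmax 0 y) - f (Rmax 0 x)) <= L * Rabs (Rmax 0 y - Rmax 0 x)).
{ apply HL; unfold Rmax;
    [destruct (Rle_dec 0 y)|destruct (Rle_dec 0 x)]; lra. }
apply (Rmult_lt_compat_r (L + 1)) in Hy2; [|lra].
unfold Rdiv in Hy2; rewrite Rmult_assoc, Rinv_l, Rmult_1_r in Hy2 by lra.
assert (H1 := Rabs_pos (y - x)); nra.
Qed.

(** * Radial solutions and their flux *)

(** [U] and [V] stand for extensions of u and u' beyond [0,1], so that derivatives are two-sided up
    to r = 1. At r = 0 the term V / r is singular and only continuity of [V] is kept, which is
    enough for the flux to be continuous there. *)
Record radial (f : R -> R) (lam : R) (U V : R -> R) : Prop := {
  radial_dU : forall r, 0 <= r <= 1 -> is_derive U r (V r);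
  radial_dV : forall r, 0 < r <= 1 ->
    is_derive V r (- V r / r - lam * f (U r));
  radial_V0 : continuity_pt V 0;
  radial_ge0 : forall r, 0 <= r <= 1 -> 0 <= U r;
  radial_U1 : U 1 = 0 }.

(** Estimates are made on the extensions [U], [V]; [du] and [ddu] are returned as well because the
    C^2 convergence to be proved concerns them. *)
Lemma solution_radial (f : R -> R) (lam mu : R) (u : R -> R) :
  is_solution f lam mu u ->
  exists du ddu U V : R -> R,
    is_C2_on Icc01 u du ddu /\
    (forall r, Ioc01 r -> ddu r = - du r / r - lam * f (u r)) /\
    radial f lam U V /\
    forall r, 0 <= r <= 1 -> U r = u r /\ V r = du r.
Proof.
intros [l0 [m0 [du [ddu [HC [Heq [Hpos [Hu0 [_ Hu1]]]]]]]]].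
destruct (derivable_extension u du 0 1) as [U HU]; [lra| |].
{ intros x Hx; apply (HC x Hx). }
destruct (derivable_extension du ddu 0 1) as [V HV]; [lra| |].
{ intros x Hx; apply (HC x Hx). }
assert (Hdd : forall r, Ioc01 r -> ddu r = - du r / r - lam * f (u r)).
{ intros r Hr; rewrite <- (Heq r Hr); field; unfold Ioc01 in Hr; lra. }
exists du, ddu, U, V; split; [exact HC|]; split; [exact Hdd|]; split.
2: { intros r Hr; split; [apply (HU r Hr)|apply (HV r Hr)]. }
constructor.
- intros r Hr; rewrite (proj1 (HV r Hr)); apply (HU r Hr).
- intros r Hr; assert (Hr' : 0 <= r <= 1) by lra.
  rewrite (proj1 (HV r Hr')), (proj1 (HU r Hr')), <- (Hdd r Hr).
  apply (HV r Hr').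
- assert (H0 : 0 <= 0 <= 1) by lra.
  apply (is_derive_continuity_pt _ _ _ (proj2 (HV 0 H0))).
- intros r Hr; rewrite (proj1 (HU r Hr)).
  destruct (Req_dec r 0) as [->|]; [lra|].
  destruct (Req_dec r 1) as [->|]; [lra|].
  left; apply Hpos; lra.
- assert (H1 : 0 <= 1 <= 1) by lra.
  now rewrite (proj1 (HU 1 H1)).
Qed.

(* Up to the factor [2 * PI] this is the integral of [- Laplacian u] over the
   disc of radius [r]. *)
Definition flux (V : R -> R) (r : R) : R := - (r * V r).

Lemma radial_V_continuity (f : R -> R) lam U V :
  radial f lam U V -> forall r, 0 <= r <= 1 -> continuity_pt V r.
Proof.
intros HR r Hr; destruct (Req_dec r 0) as [->|].
- apply HR.
- apply (is_derive_continuity_pt _ _ (- V r / r - lam * f (U r))), HR; lra.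
Qed.

Lemma radial_flux_derive (f : R -> R) lam U V :
  radial f lam U V ->
  forall r, 0 < r <= 1 -> is_derive (flux V) r (lam * f (U r) * r).
Proof.
intros HR r Hr; assert (H := radial_dV _ _ _ _ HR r Hr).
unfold flux; auto_derive; [now exists (- V r / r - lam * f (U r))|].
rewrite (is_derive_unique (fun x : R => V x) _ _ H); field; lra.
Qed.

Lemma radial_flux_continuity (f : R -> R) lam U V :
  radial f lam U V ->
  forall r, 0 <= r <= 1 -> continuity_pt (flux V) r.
Proof.
intros HR r Hr; unfold flux.
apply (continuity_pt_opp (fun r => r * V r)).
apply continuity_pt_mult; [apply derivable_continuous, derivable_id|].
eapply radial_V_continuity; eauto.
Qed.

Lemma radial_flux_le (f : R -> R) lam U V :
  (forall t, 0 <= t -> 0 <= f t) -> 0 < lam -> radial f lam U V ->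
  forall r s, 0 <= r -> r <= s -> s <= 1 -> flux V r <= flux V s.
Proof.
intros f0 l0 HR r s r0 rs s1.
apply (derive_ge0_le (flux V) (fun r => lam * f (U r) * r)); [easy|..].
- intros x Hx; apply (radial_flux_continuity _ _ _ _ HR); lra.
- intros x Hx; apply (radial_flux_derive _ _ _ _ HR); lra.
- intros x Hx; apply Rmult_le_pos; [apply Rmult_le_pos|lra]; [lra|].
  apply f0, HR; lra.
Qed.

Lemma radial_flux_ge0 (f : R -> R) lam U V :
  (forall t, 0 <= t -> 0 <= f t) -> 0 < lam -> radial f lam U V ->
  forall r, 0 <= r <= 1 -> 0 <= flux V r.
Proof.
intros f0 l0 HR r Hr.
replace 0 with (flux V 0) by (unfold flux; ring).
apply (radial_flux_le f lam U V); easy || lra.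
Qed.

Lemma radial_V_le0 (f : R -> R) lam U V :
  (forall t, 0 <= t -> 0 <= f t) -> 0 < lam -> radial f lam U V ->
  forall r, 0 < r <= 1 -> V r <= 0.
Proof.
intros f0 l0 HR r Hr.
assert (H : 0 <= flux V r) by (apply (radial_flux_ge0 f lam U V); easy || lra).
unfold flux in H; nra.
Qed.

Lemma radial_nonincreasing (f : R -> R) lam U V :
  (forall t, 0 <= t -> 0 <= f t) -> 0 < lam -> radial f lam U V ->
  forall r s, 0 <= r -> r <= s -> s <= 1 -> U s <= U r.
Proof.
intros f0 l0 HR r s r0 rs s1.
assert (H : - U r <= - U s); [|lra].
apply (derive_ge0_le (fun x => - U x) (fun x => - V x)); [easy|..].
- intros x Hx; apply continuity_pt_opp.
  apply (is_derive_continuity_pt _ _ (V x)), HR; lra.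
- intros x Hx; apply (is_derive_opp U), HR; lra.
- intros x Hx; assert (H : V x <= 0); [|lra].
  apply (radial_V_le0 f lam U V); easy || lra.
Qed.

(** The flux at r is at most the flux at 1, and dividing by r >= d costs a factor 1 / d. *)
Lemma radial_abs_V_le (f : R -> R) lam U V :
  (forall t, 0 <= t -> 0 <= f t) -> 0 < lam -> radial f lam U V ->
  forall d r, 0 < d -> d <= r <= 1 -> Rabs (V r) <= flux V 1 / d.
Proof.
intros f0 l0 HR d r d0 Hr.
assert (H1 : V r <= 0) by (apply (radial_V_le0 f lam U V); easy || lra).
assert (H2 : flux V r <= flux V 1)
  by (apply (radial_flux_le f lam U V); easy || lra).
rewrite Rabs_left1 by easy.
apply Rmult_le_reg_r with d; [easy|].
unfold Rdiv; rewrite Rmult_assoc, Rinv_l, Rmult_1_r by lra.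
unfold flux in *; nra.
Qed.

(** Integrate - U' = flux / r, which is at most flux(1) / r, from d to 1, where U vanishes. In the
    proof this is the monotonicity of U + e ln. *)
Lemma radial_le_log (f : R -> R) lam U V :
  (forall t, 0 <= t -> 0 <= f t) -> 0 < lam -> radial f lam U V ->
  forall d r, 0 < d -> d <= r <= 1 -> U r <= flux V 1 * - ln d.
Proof.
intros f0 l0 HR d r d0 Hr.
assert (HU : U r <= U d) by (apply (radial_nonincreasing f lam U V); easy || lra).
apply Rle_trans with (1 := HU).
set (e := flux V 1).
assert (H : U d + e * ln d <= U 1 + e * ln 1).
{ apply (derive_ge0_le (fun x => U x + e * ln x) (fun x => V x + e / x)); [lra|..].
  - intros x Hx; apply continuity_pt_plus.
    + apply (is_derive_continuity_pt _ _ (V x)), HR; lra.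
    + apply continuity_pt_mult; [now apply continuity_pt_const|].
      apply (is_derive_continuity_pt _ _ (/ x)), is_derive_ln; lra.
  - intros x Hx; auto_derive.
    + split; [|lra]; exists (V x); apply HR; lra.
    + rewrite (is_derive_unique (fun x : R => U x) _ (V x)) by (apply HR; lra).
      field; lra.
  - intros x Hx.
    assert (H1 : flux V x <= e) by (apply (radial_flux_le f lam U V); easy || lra).
    unfold flux in H1.
    replace (V x + e / x) with ((e + x * V x) / x) by (field; lra).
    apply Rdiv_le_0_compat; lra. }
rewrite ln_1, (radial_U1 _ _ _ _ HR) in H; lra.
Qed.

(* Pohozaev: with [E = flux V], the derivative of [E^2 / 2 + lam * r^2 * F U] is
   [2 * lam * r * F U], at most [2 * eps * E' + 2 * lam * C * r]. *)
Lemma radial_pohozaev (f F : R -> R) lam U V eps C :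
  (forall t, 0 <= t -> 0 <= f t) -> 0 < lam -> radial f lam U V ->
  F 0 = 0 -> (forall t, 0 <= t -> is_derive F t (f t)) ->
  (forall t, 0 <= t -> F t <= eps * f t + C) ->
  (flux V 1) ^ 2 / 2 <= 2 * eps * flux V 1 + C * lam.
Proof.
intros f0 l0 HR F0 HF HFf.
(* The Pohozaev function is subtracted from a primitive of its bound, so [g] is nondecreasing. It
   vanishes at 0, and at 1 the term with [F] drops out because U 1 = 0. *)
set (g := fun r => 2 * eps * flux V r + C * lam * r ^ 2 -
                   ((flux V r) ^ 2 / 2 + lam * r ^ 2 * F (U r))).
assert (H : g 0 <= g 1).
{ apply (derive_ge0_le g
    (fun r => 2 * lam * r * (eps * f (U r) + C - F (U r)))); [lra|..].
  - intros x Hx.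
    assert (HE := radial_flux_continuity _ _ _ _ HR x Hx).
    assert (HFU : continuity_pt (fun r => F (U r)) x).
    { apply (continuity_pt_comp U F).
      - apply (is_derive_continuity_pt _ _ (V x)), HR; lra.
      - apply (is_derive_continuity_pt _ _ (f (U x))), HF, HR; lra. }
    assert (Hc : forall c, continuity_pt (fun _ => c) x)
      by (intros c; now apply continuity_pt_const).
    assert (Hp : forall n, continuity_pt (fun y => y ^ n) x)
      by (intros n; apply derivable_continuous, derivable_pow).
    apply continuity_pt_minus; apply continuity_pt_plus.
    + now apply continuity_pt_mult.
    + now apply continuity_pt_mult.
    + apply (continuity_pt_ext (fun y => flux V y * flux V y * / 2)).
      { intros y; field. }
      now apply continuity_pt_mult; [apply continuity_pt_mult|].
    + now apply continuity_pt_mult; [apply continuity_pt_mult|].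
  - intros x Hx.
    assert (HE := radial_flux_derive _ _ _ _ HR x ltac:(lra)).
    assert (HU := radial_dU _ _ _ _ HR x ltac:(lra)).
    assert (HFU := HF (U x) (radial_ge0 _ _ _ _ HR x ltac:(lra))).
    unfold g; auto_derive.
    + repeat split; eexists; eassumption.
    + rewrite (is_derive_unique (fun x : R => flux V x) _ _ HE).
      rewrite (is_derive_unique (fun x : R => U x) _ _ HU).
      rewrite (is_derive_unique (fun x : R => F x) _ _ HFU).
      unfold flux; field.
  - intros x Hx.
    assert (H := HFf (U x) (radial_ge0 _ _ _ _ HR x ltac:(lra))).
    apply Rmult_le_pos; [|lra]; nra. }
unfold g in H; rewrite (radial_U1 _ _ _ _ HR), F0 in H.
replace (flux V 0) with 0 in H by (unfold flux; ring).
ring_simplify in H; lra.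
Qed.

(* Between [a / 2] and [a] the flux grows by at least [lam * K * U a * a^2 / 4],
   while [U a >= flux V a * - ln a]. *)
Lemma radial_lam_le (f : R -> R) lam U V K T a :
  (forall t, 0 <= t -> 0 <= f t) -> 0 < lam -> radial f lam U V ->
  0 < K -> (forall t, T <= t -> K * t <= f t) ->
  0 < a < 1 -> 0 < U a -> T <= U a ->
  lam * K * a ^ 2 / 4 * - ln a <= 1.
Proof.
intros f0 l0 HR K0 HK Ha Ua0 UaT.
assert (ln0 : 0 < - ln a) by (assert (H := ln_increasing a 1); rewrite ln_1 in H; lra).
set (e := flux V a).
(* Beyond a the flux is at least e, so - U' >= e / x on [a,1]; integrate up to U 1 = 0. *)
assert (He : e * - ln a <= U a).
{ assert (H : U 1 + e * ln 1 <= U a + e * ln a); [|rewrite ln_1, (radial_U1 _ _ _ _ HR) in H; lra].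
  assert (H : - (U a + e * ln a) <= - (U 1 + e * ln 1)); [|lra].
  apply (derive_ge0_le (fun x => - (U x + e * ln x)) (fun x => - (V x + e / x))); [lra|..].
  - intros x Hx; apply continuity_pt_opp, continuity_pt_plus.
    + apply (is_derive_continuity_pt _ _ (V x)), HR; lra.
    + apply continuity_pt_mult; [now apply continuity_pt_const|].
      apply (is_derive_continuity_pt _ _ (/ x)), is_derive_ln; lra.
  - intros x Hx; auto_derive.
    + split; [|lra]; exists (V x); apply HR; lra.
    + rewrite (is_derive_unique (fun x : R => U x) _ (V x)) by (apply HR; lra).
      field; lra.
  - intros x Hx.
    assert (H1 : e <= flux V x) by (apply (radial_flux_le f lam U V); easy || lra).
    unfold flux in H1.
    replace (- (V x + e / x)) with ((- (x * V x) - e) / x) by (field; lra).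
    apply Rdiv_le_0_compat; lra. }
(* Mean value theorem on an interval of length a / 2 whose points are at least a / 2: this gives a^2
   / 4. The flux at a / 2 is nonnegative, and [U] is at least [U a] to the left of a. *)
assert (He2 : lam * K * U a * a ^ 2 / 4 <= e).
{ destruct (MVT_open (flux V) (fun r => lam * f (U r) * r) (a / 2) a)
    as [c [Hc E]]; [lra|..].
  - intros x Hx; apply (radial_flux_continuity _ _ _ _ HR); lra.
  - intros x Hx; apply (radial_flux_derive _ _ _ _ HR); lra.
  - assert (H0 : 0 <= flux V (a / 2))
      by (apply (radial_flux_ge0 f lam U V); easy || lra).
    assert (HUc : U a <= U c)
      by (apply (radial_nonincreasing f lam U V); easy || lra).
    assert (Hf : K * U a <= f (U c)).
    { apply Rle_trans with (K * U c); [nra|]; apply HK; lra. }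
    fold e in E.
    assert (H1 : lam * (K * U a) <= lam * f (U c)) by nra.
    assert (H2 : 0 <= lam * (K * U a)) by (assert (0 < K * U a) by nra; nra).
    assert (H3 : lam * (K * U a) * (a / 2) <= lam * f (U c) * c)
      by (apply Rmult_le_compat; lra).
    assert (H4 : lam * (K * U a) * (a / 2) * (a - a / 2) <=
                 lam * f (U c) * c * (a - a / 2))
      by (apply Rmult_le_compat_r; lra).
    nra. }
(* The lower bound on e is linear in [U a], as is the upper bound, so [U a] cancels and a bound
   independent of the solution remains. *)
apply Rmult_le_reg_r with (U a); [easy|].
apply Rle_trans with (e * - ln a); [|lra].
apply Rle_trans with (lam * K * U a * a ^ 2 / 4 * - ln a); [right; field|].
apply Rmult_le_compat_r; lra.
Qed.

(** * Regularity and growth of the nonlinearity *)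

Lemma D_in_is_derive (g dg : R -> R) (D : R -> Prop) (a b x : R) :
  (forall y, a < y < b -> D y) -> a < x < b -> D_in g dg D x ->
  is_derive g x (dg x).
Proof.
intros HD Hx Hg; apply is_derive_Reals; intros eps Heps.
destruct (Hg eps Heps) as [alp [Halp H]].
assert (Hd : 0 < Rmin alp (Rmin (x - a) (b - x)))
  by (repeat apply Rmin_glb_lt; lra).
exists (mkposreal _ Hd); intros k k0 Hk; simpl in Hk.
assert (Hk1 := Rmin_l alp (Rmin (x - a) (b - x))).
assert (Hk2 := Rmin_r alp (Rmin (x - a) (b - x))).
assert (Hk3 := Rmin_l (x - a) (b - x)).
assert (Hk4 := Rmin_r (x - a) (b - x)).
specialize (H (x + k)); simpl in H; unfold Rdist in H.
replace (x + k - x) with k in H by ring.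
apply H; split; [split; [|lra]|lra].
apply HD; split_Rabs; lra.
Qed.

Lemma loc_lipschitz_bounded (f : R -> R) :
  loc_lipschitz f ->
  forall M, exists B, 0 <= B /\ forall t, 0 <= t <= M -> Rabs (f t) <= B.
Proof.
intros Hf M; destruct (Hf M) as [L [L0 HL]].
exists (Rabs (f 0) + L * Rabs M); split.
- assert (H := Rabs_pos (f 0)); assert (H1 := Rabs_pos M); nra.
- intros t Ht; assert (H := HL t 0 ltac:(lra) ltac:(lra)).
  assert (H1 : L * Rabs (t - 0) <= L * Rabs M).
  { apply Rmult_le_compat_l; [easy|]; split_Rabs; lra. }
  assert (H2 := Rabs_triang (f t - f 0) (f 0)).
  replace (f t - f 0 + f 0) with (f t) in H2 by ring; lra.
Qed.

Lemma loc_lipschitz_mult (f g : R -> R) :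
  loc_lipschitz f -> loc_lipschitz g -> loc_lipschitz (fun t => f t * g t).
Proof.
intros Hf Hg M.
destruct (loc_lipschitz_bounded f Hf M) as [Bf [Bf0 HBf]].
destruct (loc_lipschitz_bounded g Hg M) as [Bg [Bg0 HBg]].
destruct (Hf M) as [Lf [Lf0 HLf]], (Hg M) as [Lg [Lg0 HLg]].
exists (Bf * Lg + Bg * Lf); split; [nra|]; intros x y Hx Hy.
replace (f x * g x - f y * g y) with (f x * (g x - g y) + g y * (f x - f y))
  by ring.
eapply Rle_trans; [apply Rabs_triang|]; rewrite !Rabs_mult, Rmult_plus_distr_r.
rewrite !Rmult_assoc.
apply Rplus_le_compat; apply Rmult_le_compat; auto using Rabs_pos.
Qed.

Lemma loc_lipschitz_exp (g : R -> R) :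
  loc_lipschitz g -> loc_lipschitz (fun t => exp (g t)).
Proof.
intros Hg M.
destruct (loc_lipschitz_bounded g Hg M) as [B [B0 HB]].
destruct (Hg M) as [L [L0 HL]].
exists (exp B * L); split; [assert (H := exp_pos B); nra|]; intros x y Hx Hy.
assert (He : lipschitz_between (- B) B exp (exp B)).
{ apply lipschitz_derive with exp.
  - intros z _; apply derivable_continuous, derivable_exp.
  - intros z _; apply is_derive_exp.
  - intros z Hz; rewrite Rabs_pos_eq by (left; apply exp_pos).
    left; apply exp_increasing; lra. }
eapply Rle_trans; [apply He; apply Rabs_le_between; auto|].
rewrite Rmult_assoc; apply Rmult_le_compat_l; [left; apply exp_pos|auto].
Qed.

(** The constant is the maximum of |dh| on [0,b]. Since [h] is differentiable only from the right at
    0, the mean value theorem is applied to a two-sided extension, and [dh] is clamped to be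
    continuous on the whole line. *)
Lemma loc_lipschitz_C1 (h dh : R -> R) : is_C1_on Ici0 h dh -> loc_lipschitz h.
Proof.
intros Hh M.
(* [M] may be negative or 0, whereas the extension needs a nondegenerate interval. *)
set (b := Rabs M + 1); assert (Hb : 0 < b) by (assert (H := Rabs_pos M); unfold b; lra).
assert (HMb : M <= b) by (assert (H := Rle_abs M); unfold b; lra).
destruct (derivable_extension h dh 0 b Hb) as [H HH].
{ intros x Hx; apply D_in_imp with Ici0; [unfold Ici0; intros; lra|].
  apply Hh; unfold Ici0; lra. }
set (g := fun t => Rabs (dh (Rmax 0 t))).
assert (Hg : continuity g).
{ intros x; unfold g.
  apply (continuity_pt_comp (fun t => dh (Rmax 0 t)) Rabs); [|apply Rcontinuity_abs].
  assert (Hx0 : Ici0 (Rmax 0 x)) by (unfold Ici0; apply Rmax_l).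
  intros eps Heps; destruct (proj2 (Hh _ Hx0) eps Heps) as [alp [Halp Hc]].
  exists alp; split; [easy|]; intros y [_ Hy]; simpl in *; unfold Rdist in *.
  (* [continue_in] only speaks of points distinct from the base point, and clamping may merge y with
     x. *)
  destruct (Req_dec (Rmax 0 y) (Rmax 0 x)) as [->|Hne].
  - rewrite Rminus_diag, Rabs_R0; lra.
  - apply Hc; split; [split; [apply Rmax_l|easy]|].
    apply Rle_lt_trans with (2 := Hy).
    unfold Rmax; destruct (Rle_dec 0 y), (Rle_dec 0 x); split_Rabs; lra. }
destruct (continuity_ab_maj g 0 b) as [m [Hm _]]; [lra|intros; apply Hg|].
exists (g m); split; [apply Rabs_pos|]; intros x y Hx Hy.
rewrite <- (proj1 (HH x ltac:(lra))), <- (proj1 (HH y ltac:(lra))).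
apply (lipschitz_derive H dh 0 b); [| | |lra|lra].
- intros z Hz; apply (is_derive_continuity_pt _ _ (dh z)), HH, Hz.
- intros z Hz; apply HH; lra.
- intros z Hz; apply Rle_trans with (g z); [|apply Hm; lra].
  unfold g; rewrite Rmax_right; lra.
Qed.

Lemma is_derive_rpow (p t : R) :
  0 < t -> is_derive (fun x => rpow x p) t (p * Rpower t (p - 1)).
Proof.
intros Ht; apply is_derive_ext_loc with (fun x => Rpower x p).
- exists (mkposreal t Ht); intros y Hy.
  unfold ball in Hy; simpl in Hy; unfold AbsRing_ball, abs, minus, plus, opp in Hy;
    simpl in Hy.
  unfold rpow; destruct Rlt_dec as [|Hn]; [easy|].
  exfalso; apply Hn; split_Rabs; lra.
- apply is_derive_Reals, derivable_pt_lim_power, Ht.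
Qed.

Lemma rpow_continuity (p : R) : 1 <= p -> continuity (fun t => rpow t p).
Proof.
intros Hp x; destruct (Rlt_dec 0 x) as [Hx|Hx].
- apply (is_derive_continuity_pt _ _ (p * Rpower x (p - 1))), is_derive_rpow, Hx.
- intros eps Heps.
  (* Here x <= 0, so a positive y within this radius is below both 1 and eps; then y^p = y^(p-1) y
     <= y < eps. *)
  assert (Hd : 0 < Rmin 1 eps) by (apply Rmin_glb_lt; lra).
  exists (Rmin 1 eps); split; [easy|].
  intros y [_ Hy]; simpl in *; unfold Rdist in *.
  assert (Hm1 := Rmin_l 1 eps); assert (Hm2 := Rmin_r 1 eps).
  assert (Hxp : rpow x p = 0) by (unfold rpow; destruct (Rlt_dec 0 x); easy).
  rewrite Hxp; unfold rpow; destruct (Rlt_dec 0 y) as [Hy0|Hy0];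
    [|rewrite Rminus_diag, Rabs_R0; lra].
  assert (Hyx : y < Rmin 1 eps) by (split_Rabs; lra).
  assert (Hle : Rpower y (p - 1) <= 1).
  { apply Rle_trans with (Rpower 1 (p - 1)).
    - apply Rle_Rpower_l; lra.
    - unfold Rpower; rewrite ln_1, Rmult_0_r, exp_0; lra. }
  assert (E : Rpower y p = Rpower y (p - 1) * y).
  { rewrite <- (Rpower_1 y) at 3 by easy; rewrite <- Rpower_plus; f_equal; ring. }
  assert (H0 : 0 < Rpower y p) by apply exp_pos.
  rewrite Rminus_0_r, Rabs_pos_eq by lra; nra.
Qed.

Lemma loc_lipschitz_rpow (p : R) : 1 <= p -> loc_lipschitz (fun t => rpow t p).
Proof.
intros Hp M; exists (p * Rpower (Rabs M + 1) (p - 1)); split.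
{ assert (H : 0 < Rpower (Rabs M + 1) (p - 1)) by apply exp_pos; nra. }
apply lipschitz_derive with (fun t => p * Rpower t (p - 1)).
- intros x _; now apply rpow_continuity.
- intros x Hx; apply is_derive_rpow; lra.
- intros x Hx.
  assert (H : 0 < Rpower x (p - 1)) by apply exp_pos.
  rewrite Rabs_pos_eq by nra; apply Rmult_le_compat_l; [lra|].
  apply Rle_Rpower_l; [lra|]; split; [lra|].
  assert (H1 := Rle_abs M); lra.
Qed.

(** This says that f'/f tends to infinity, written without division. The requirement 1 <= T serves
    the comparison with a line in [fast_growing_linear]. *)
Definition fast_growing (f : R -> R) : Prop :=
  forall K, exists T, 1 <= T /\ forall t, T <= t ->
    0 < f t /\ exists d, is_derive f t d /\ K * f t <= d.

Lemma nonlin_loc_lipschitz (p : R) (h dh : R -> R) :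
  1 <= p -> is_C1_on Ici0 h dh -> loc_lipschitz (nonlin h p).
Proof.
intros Hp Hh; apply loc_lipschitz_mult.
- exact (loc_lipschitz_C1 h dh Hh).
- apply loc_lipschitz_exp, loc_lipschitz_rpow, Hp.
Qed.

(** Here f'/f = h'/h + p t^(p-1). The limit hypothesis, taken with tolerance 1, gives h'/h >= -
    t^(p-1) for large t, so f'/f >= (p-1) t^(p-1) >= t because p >= 2. *)
Lemma nonlin_fast_growing (p : R) (h dh : R -> R) :
  2 <= p -> is_C1_on Ici0 h dh ->
  (exists t0, 0 < t0 /\ forall t, t0 <= t -> 0 < h t) ->
  is_lim (fun t => dh t / (Rpower t (p - 1) * h t)) p_infty 0 ->
  fast_growing (nonlin h p).
Proof.
intros Hp Hh [t0 [Ht0 Hpos]] Hlim K.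
apply is_lim_spec in Hlim.
destruct (Hlim (mkposreal 1 Rlt_0_1)) as [M HM]; simpl in HM.
(* [M + 1] because the limit bound [HM] asks for t strictly above [M]. *)
exists (Rmax (Rmax 1 K) (Rmax t0 (M + 1))); split.
{ eapply Rle_trans; [|apply Rmax_l]; apply Rmax_l. }
intros t Ht.
assert (Ht1 : 1 <= t /\ K <= t).
{ split; (eapply Rle_trans; [|exact Ht]); (eapply Rle_trans; [|apply Rmax_l]);
    [apply Rmax_l|apply Rmax_r]. }
assert (Ht2 : t0 <= t /\ M + 1 <= t).
{ split; (eapply Rle_trans; [|exact Ht]); (eapply Rle_trans; [|apply Rmax_r]);
    [apply Rmax_l|apply Rmax_r]. }
assert (Hht := Hpos t (proj1 Ht2)).
assert (He := exp_pos (rpow t p)).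
assert (Hft : 0 < nonlin h p t) by (unfold nonlin; nra).
split; [exact Hft|].
exists (dh t * exp (rpow t p) + h t * (p * Rpower t (p - 1) * exp (rpow t p))).
split.
- assert (Hdh : is_derive h t (dh t)).
  { apply (D_in_is_derive h dh Ici0 0 (t + 1)); [intros; unfold Ici0; lra|lra|].
    apply Hh; unfold Ici0; lra. }
  assert (Hdr := is_derive_rpow p t ltac:(lra)).
  unfold nonlin; auto_derive; [repeat split; eexists; eassumption|].
  rewrite (is_derive_unique (fun x : R => h x) _ _ Hdh).
  rewrite (is_derive_unique (fun x : R => rpow x p) _ _ Hdr); ring.
- specialize (HM t ltac:(lra)); rewrite Rminus_0_r in HM.
  set (q := Rpower t (p - 1)) in *.
  assert (Hq : t <= q).
  { unfold q; rewrite <- (Rpower_1 t) at 1 by lra; apply Rle_Rpower; lra. }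
  assert (Hd : - (q * h t) <= dh t).
  { apply Rabs_def2 in HM; destruct HM as [_ HM].
    apply (Rmult_lt_compat_r (q * h t)) in HM; [|nra].
    replace (dh t / (q * h t) * (q * h t)) with (dh t) in HM by (field; nra); lra. }
  unfold nonlin in *.
  replace (dh t * exp (rpow t p) + h t * (p * q * exp (rpow t p)))
    with ((dh t + p * q * h t) * exp (rpow t p)) by ring.
  rewrite <- Rmult_assoc; apply Rmult_le_compat_r; [lra|].
  assert (0 < q * h t) by nra.
  assert (K * h t <= q * h t) by nra; nra.
Qed.

(** Integrating the clamped function gives [F] a two-sided derivative even at t = 0, the value taken
    by U at r = 1 in the Pohozaev argument. *)
Lemma loc_lipschitz_primitive (f : R -> R) :
  loc_lipschitz f ->
  exists F : R -> R, F 0 = 0 /\ forall t, 0 <= t -> is_derive F t (f t).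
Proof.
intros Hf; set (g := fun t => f (Rmax 0 t)).
assert (Hg : forall t, continuous g t).
{ intros t; apply continuity_pt_filterlim, loc_lipschitz_continuous, Hf. }
exists (RInt g 0); split; [exact (RInt_point 0 g)|]; intros t Ht.
replace (f t) with (g t) by (unfold g; rewrite Rmax_right; easy).
apply is_derive_RInt with 0; [|apply Hg].
apply filter_forall; intros x.
apply (@RInt_correct R_CompleteNormedModule), (@ex_RInt_continuous R_CompleteNormedModule).
intros; apply Hg.
Qed.

(** Once f' >= f / eps, that is beyond T, the function eps f - F is nondecreasing; up to T, F is at
    most F T. Hence C = F T serves on both ranges. *)
Lemma fast_growing_primitive (f F : R -> R) (eps : R) :
  (forall t, 0 <= t -> 0 <= f t) -> fast_growing f ->
  F 0 = 0 -> (forall t, 0 <= t -> is_derive F t (f t)) -> 0 < eps ->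
  exists C, 0 <= C /\ forall t, 0 <= t -> F t <= eps * f t + C.
Proof.
intros f0 Hf F0 HF He.
destruct (Hf (/ eps)) as [T [HT HfT]].
assert (Finc : forall s t, 0 <= s -> s <= t -> F s <= F t).
{ intros s t Hs Hst; apply (derive_ge0_le F f); [easy|..].
  - intros x Hx; apply (is_derive_continuity_pt _ _ (f x)), HF; lra.
  - intros x Hx; apply HF; lra.
  - intros x Hx; apply f0; lra. }
exists (F T); split; [rewrite <- F0; apply Finc; lra|]; intros t Ht.
assert (Hft := f0 t Ht).
destruct (Rle_lt_dec t T) as [HtT|HtT].
{ assert (F t <= F T) by (apply Finc; lra); nra. }
assert (Hd : forall x, T <= x -> is_derive f x (Derive f x) /\ f x <= eps * Derive f x).
{ intros x Hx; destruct (HfT x Hx) as [_ [d [Hdx Hle]]].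
  rewrite (is_derive_unique _ _ _ Hdx); split; [easy|].
  apply (Rmult_le_compat_l eps) in Hle; [|lra].
  rewrite <- Rmult_assoc, Rinv_r, Rmult_1_l in Hle; lra. }
assert (H : eps * f T - F T <= eps * f t - F t).
{ apply (derive_ge0_le (fun x => eps * f x - F x)
                       (fun x => eps * Derive f x - f x)); [lra|..].
  - intros x Hx; apply continuity_pt_minus.
    + apply continuity_pt_mult; [now apply continuity_pt_const|].
      apply (is_derive_continuity_pt _ _ (Derive f x)), Hd; lra.
    + apply (is_derive_continuity_pt _ _ (f x)), HF; lra.
  - intros x Hx; assert (H1 := proj1 (Hd x ltac:(lra))).
    assert (H2 := HF x ltac:(lra)).
    auto_derive; [repeat split; eexists; eassumption|].
    rewrite (is_derive_unique (fun x : R => F x) _ _ H2).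
    change (Derive (fun x : R => f x) x) with (Derive f x); ring.
  - intros x Hx; assert (H1 := proj2 (Hd x ltac:(lra))); lra. }
assert (HfT0 := f0 T ltac:(lra)); nra.
Qed.

(** The line through the origin and (T, f T) has slope f T / T <= f T since T >= 1, while f' >= f >=
    f T beyond T, so f stays above that line. *)
Lemma fast_growing_linear (f : R -> R) :
  fast_growing f ->
  exists K T, 0 < K /\ 0 < T /\ forall t, T <= t -> K * t <= f t.
Proof.
intros Hf; destruct (Hf 1) as [T [HT HfT]].
assert (Hd : forall x, T <= x -> is_derive f x (Derive f x) /\ f x <= Derive f x).
{ intros x Hx; destruct (HfT x Hx) as [_ [d [Hdx Hle]]].
  rewrite (is_derive_unique _ _ _ Hdx); split; [easy|lra]. }
assert (HT0 := proj1 (HfT T (Rle_refl T))).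
assert (Hc : forall x, T <= x -> continuity_pt f x).
{ intros x Hx; apply (is_derive_continuity_pt _ _ (Derive f x)), Hd, Hx. }
assert (Hinc : forall t, T <= t -> f T <= f t).
{ intros t Ht; apply (derive_ge0_le f (Derive f)); [easy|..].
  - intros x Hx; apply Hc; lra.
  - intros x Hx; apply Hd; lra.
  - intros x Hx; assert (H := proj2 (Hd x ltac:(lra))).
    assert (H1 := proj1 (HfT x ltac:(lra))); lra. }
exists (f T / T), T; split; [apply Rdiv_lt_0_compat; lra|]; split; [lra|].
assert (HK : f T / T <= f T).
{ apply Rmult_le_reg_r with T; [lra|].
  unfold Rdiv; rewrite Rmult_assoc, Rinv_l by lra; nra. }
intros t Ht.
assert (H : f T - f T / T * T <= f t - f T / T * t).
{ apply (derive_ge0_le (fun x => f x - f T / T * x)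
                       (fun x => Derive f x - f T / T)); [easy|..].
  - intros x Hx; apply continuity_pt_minus; [apply Hc; lra|].
    apply continuity_pt_mult; [now apply continuity_pt_const|].
    apply derivable_continuous, derivable_id.
  - intros x Hx; assert (H1 := proj1 (Hd x ltac:(lra))).
    auto_derive; [eexists; eassumption|].
    change (Derive (fun x : R => f x) x) with (Derive f x); ring.
  - intros x Hx; assert (H1 := proj2 (Hd x ltac:(lra))).
    assert (H2 := Hinc x ltac:(lra)); lra. }
unfold Rdiv at 1 in H; rewrite Rmult_assoc, Rinv_l in H by lra; lra.
Qed.

(** * Stability of the Cauchy problem at r = 1 *)

Lemma Rabs_le_of_sq (x y : R) : 0 <= y -> x ^ 2 <= y ^ 2 -> Rabs x <= y.
Proof. intros Hy H; split_Rabs; nra. Qed.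

(* Gronwall, backwards from [r = 1], for the energy [(U1 - U2)^2 + (V1 - V2)^2]. *)
Lemma radial_stability_sq (f : R -> R) lam1 U1 V1 lam2 U2 V2 d M L B Lam :
  0 < d -> 0 <= L -> 0 <= lam1 <= Lam ->
  radial f lam1 U1 V1 -> radial f lam2 U2 V2 ->
  lipschitz_between 0 M f L -> (forall t, 0 <= t <= M -> Rabs (f t) <= B) ->
  (forall r, d <= r <= 1 -> U1 r <= M /\ U2 r <= M) ->
  forall r, d <= r <= 1 ->
    (U1 r - U2 r) ^ 2 + (V1 r - V2 r) ^ 2 <=
    exp (2 + 2 / d + Lam * L) * (1 + B ^ 2) *
    ((V1 1 - V2 1) ^ 2 + (lam1 - lam2) ^ 2).
Proof.
intros d0 L0 Hlam HR1 HR2 HL HB HM r Hr.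
(* The rate collects 1 from the cross term (U1 - U2)(V1 - V2), 1 from the forcing by lam1 - lam2, 2
   / d from the damping V / r, and [Lam * L] from the nonlinearity. [eta] is the part of the forcing
   that the energy does not absorb. *)
set (A := 2 + 2 / d + Lam * L).
set (eta := (B * (lam1 - lam2)) ^ 2).
set (G := fun r => (U1 r - U2 r) ^ 2 + (V1 r - V2 r) ^ 2).
assert (d2 : 0 < 2 / d) by (apply Rdiv_lt_0_compat; lra).
assert (A2 : 2 <= A) by (unfold A; nra).
assert (eta0 : 0 <= eta) by apply pow2_ge_0.
assert (G0 : forall s, 0 <= G s)
  by (intros s; unfold G; apply Rplus_le_le_0_compat; apply pow2_ge_0).
set (dG := fun s => 2 * (U1 s - U2 s) * (V1 s - V2 s) +
  2 * (V1 s - V2 s) * ((- V1 s / s - lam1 * f (U1 s)) -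
                       (- V2 s / s - lam2 * f (U2 s)))).
assert (HG : forall s, d <= s <= 1 -> is_derive G s (dG s)).
{ intros s Hs.
  assert (H1 := radial_dU _ _ _ _ HR1 s ltac:(lra)).
  assert (H2 := radial_dU _ _ _ _ HR2 s ltac:(lra)).
  assert (H3 := radial_dV _ _ _ _ HR1 s ltac:(lra)).
  assert (H4 := radial_dV _ _ _ _ HR2 s ltac:(lra)).
  unfold G; auto_derive; [repeat split; eexists; eassumption|].
  rewrite (is_derive_unique (fun x : R => U1 x) _ _ H1).
  rewrite (is_derive_unique (fun x : R => U2 x) _ _ H2).
  rewrite (is_derive_unique (fun x : R => V1 x) _ _ H3).
  rewrite (is_derive_unique (fun x : R => V2 x) _ _ H4).
  unfold dG; field; lra. }
assert (HdG : forall s, d <= s <= 1 -> - (A * G s) - eta <= dG s).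
{ intros s Hs; unfold dG, eta.
  destruct (HM s Hs) as [HM1 HM2].
  assert (HU1 := radial_ge0 _ _ _ _ HR1 s ltac:(lra)).
  assert (HU2 := radial_ge0 _ _ _ _ HR2 s ltac:(lra)).
  assert (Hf := HL (U1 s) (U2 s) ltac:(lra) ltac:(lra)).
  assert (Hb := HB (U2 s) ltac:(lra)).
  set (x := U1 s - U2 s) in *; set (k := V1 s - V2 s).
  set (y := f (U1 s) - f (U2 s)) in *; set (z := f (U2 s)) in *.
  (* lam1 f(U1) - lam2 f(U2) is split as lam1 (f(U1) - f(U2)) + (lam1 - lam2) f(U2): the first part
     is Lipschitz in U, the second is a bounded forcing. *)
  replace (2 * k * (- V1 s / s - lam1 * f (U1 s) - (- V2 s / s - lam2 * z)))
    with (- (2 * k ^ 2 / s) - 2 * lam1 * (k * y) - 2 * (k * ((lam1 - lam2) * z)))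
    by (unfold k, y, z; field; lra).
  assert (E : G s = x ^ 2 + k ^ 2) by reflexivity; rewrite E.
  assert (I1 : - (x ^ 2 + k ^ 2) <= 2 * x * k)
    by (assert (H := pow2_ge_0 (x + k)); nra).
  assert (I2 : 2 * k ^ 2 / s <= 2 / d * k ^ 2).
  { replace (2 * k ^ 2 / s) with (2 * k ^ 2 * / s) by (field; lra).
    replace (2 / d * k ^ 2) with (2 * k ^ 2 * / d) by (field; lra).
    apply Rmult_le_compat_l; [assert (H := pow2_ge_0 k); lra|].
    apply Rinv_le_contravar; lra. }
  assert (I3 : 2 * lam1 * (k * y) <= Lam * L * (x ^ 2 + k ^ 2)).
  { assert (H : 2 * (k * y) <= L * (x ^ 2 + k ^ 2)).
    { assert (H1 : k * y <= Rabs k * (L * Rabs x)).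
      { apply Rle_trans with (1 := Rle_abs _); rewrite Rabs_mult.
        apply Rmult_le_compat_l; [apply Rabs_pos|exact Hf]. }
      assert (H2 := pow2_ge_0 (Rabs x - Rabs k)).
      rewrite <- (pow2_abs x), <- (pow2_abs k).
      assert (H3 : 2 * (Rabs k * Rabs x) <= Rabs x ^ 2 + Rabs k ^ 2) by nra.
      apply (Rmult_le_compat_l L) in H3; lra. }
    assert (H0 : 0 <= L * (x ^ 2 + k ^ 2)).
    { apply Rmult_le_pos; [easy|]; apply Rplus_le_le_0_compat; apply pow2_ge_0. }
    apply Rle_trans with (lam1 * (L * (x ^ 2 + k ^ 2))); [nra|].
    rewrite Rmult_assoc; apply Rmult_le_compat_r; lra. }
  assert (I4 : 2 * (k * ((lam1 - lam2) * z)) <= k ^ 2 + (B * (lam1 - lam2)) ^ 2).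
  { assert (H : z ^ 2 <= B ^ 2).
    { rewrite <- (pow2_abs z); apply pow_incr; split; [apply Rabs_pos|easy]. }
    assert (H1 : ((lam1 - lam2) * z) ^ 2 <= (B * (lam1 - lam2)) ^ 2).
    { rewrite !Rpow_mult_distr, Rmult_comm.
      apply Rmult_le_compat_r; [apply pow2_ge_0|easy]. }
    assert (H2 := pow2_ge_0 (k - (lam1 - lam2) * z)); nra. }
  assert (X0 := pow2_ge_0 x); assert (K0 := pow2_ge_0 k).
  assert (I5 : 2 / d * k ^ 2 <= 2 / d * (x ^ 2 + k ^ 2)) by nra.
  unfold A; lra. }
(* The derivative is at least (A - 1) eta exp(A s), which is nonnegative since A >= 2. Going
   backwards, it is a lower bound on G' that controls G r by G 1. *)
assert (HQ : (G r + eta) * exp (A * r) <= (G 1 + eta) * exp (A * 1)).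
{ apply (derive_ge0_le (fun s => (G s + eta) * exp (A * s))
     (fun s => (dG s + A * (G s + eta)) * exp (A * s))); [lra|..].
  - intros s Hs; apply continuity_pt_mult.
    + apply continuity_pt_plus; [|now apply continuity_pt_const].
      apply (is_derive_continuity_pt _ _ (dG s)), HG; lra.
    + apply (is_derive_continuity_pt _ _ (A * exp (A * s))).
      auto_derive; [easy|ring].
  - intros s Hs; assert (H := HG s ltac:(lra)).
    auto_derive; [eexists; eassumption|].
    rewrite (is_derive_unique (fun x : R => G x) _ _ H); ring.
  - intros s Hs; assert (H := HdG s ltac:(lra)).
    apply Rmult_le_pos; [nra|left; apply exp_pos]. }
assert (E1 : G 1 = (V1 1 - V2 1) ^ 2).
{ unfold G; rewrite (radial_U1 _ _ _ _ HR1), (radial_U1 _ _ _ _ HR2); ring. }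
rewrite Rmult_1_r, E1 in HQ.
assert (He : 1 <= exp (A * r)).
{ assert (H := exp_ineq1_le (A * r)); nra. }
assert (HG0 := G0 r).
apply Rle_trans with (((V1 1 - V2 1) ^ 2 + eta) * exp A).
{ apply Rle_trans with (2 := HQ); fold (G r); nra. }
unfold eta; rewrite (Rmult_comm _ (exp A)), Rmult_assoc.
apply Rmult_le_compat_l; [left; apply exp_pos|].
assert (H1 := pow2_ge_0 (B * (V1 1 - V2 1))).
assert (H2 := pow2_ge_0 (lam1 - lam2)); nra.
Qed.

(** [K] is chosen before the solutions, so one constant serves all pairs of terms of the
    sequence. *)
Lemma radial_stability (f : R -> R) d M Lam :
  loc_lipschitz f -> 0 < d ->
  exists K, 0 <= K /\ forall lam1 U1 V1 lam2 U2 V2,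
  0 <= lam1 <= Lam -> radial f lam1 U1 V1 -> radial f lam2 U2 V2 ->
  (forall r, d <= r <= 1 -> U1 r <= M /\ U2 r <= M) ->
  forall r, d <= r <= 1 ->
    Rabs (U1 r - U2 r) <= K * (Rabs (V1 1 - V2 1) + Rabs (lam1 - lam2)) /\
    Rabs (V1 r - V2 r) <= K * (Rabs (V1 1 - V2 1) + Rabs (lam1 - lam2)).
Proof.
intros Hf d0.
destruct (Hf M) as [L [L0 HL]].
destruct (loc_lipschitz_bounded f Hf M) as [B [B0 HB]].
set (K0 := exp (2 + 2 / d + Lam * L) * (1 + B ^ 2)).
assert (HK0 : 0 <= K0).
{ apply Rmult_le_pos; [left; apply exp_pos|]; assert (H := pow2_ge_0 B); lra. }
(* Its square dominates [K0], which avoids a square root. *)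
exists (K0 + 1); split; [lra|].
intros lam1 U1 V1 lam2 U2 V2 Hlam HR1 HR2 HM r Hr.
assert (H := radial_stability_sq f lam1 U1 V1 lam2 U2 V2 d M L B Lam
  d0 L0 Hlam HR1 HR2 HL HB HM r Hr); fold K0 in H.
rewrite <- (pow2_abs (V1 1 - V2 1)), <- (pow2_abs (lam1 - lam2)) in H.
assert (Ha := Rabs_pos (V1 1 - V2 1)); assert (Hb := Rabs_pos (lam1 - lam2)).
set (a := Rabs (V1 1 - V2 1)) in *; set (b := Rabs (lam1 - lam2)) in *.
assert (Hab : K0 * (a ^ 2 + b ^ 2) <= ((K0 + 1) * (a + b)) ^ 2).
{ rewrite Rpow_mult_distr; apply Rmult_le_compat; nra. }
assert (HU2 := pow2_ge_0 (U1 r - U2 r)); assert (HV2 := pow2_ge_0 (V1 r - V2 r)).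
split; apply Rabs_le_of_sq; nra.
Qed.

(** * Derivatives of pointwise limits *)

Lemma lipschitz_limit (v : nat -> R -> R) (w : R -> R) (a b C : R) :
  (forall n, lipschitz_between a b (v n) C) ->
  (forall x, a <= x <= b -> is_lim_seq (fun n => v n x) (w x)) ->
  lipschitz_between a b w C.
Proof.
intros Hv Hw x y Hx Hy.
apply (is_lim_seq_le (fun n => Rabs (v n x - v n y)) (fun _ => C * Rabs (x - y))
  (Rabs (w x - w y)) (C * Rabs (x - y))).
- intros n; apply Hv; easy.
- apply (is_lim_seq_abs _ (w x - w y)), is_lim_seq_minus'; auto.
- apply is_lim_seq_const.
Qed.

(** By the mean value theorem the first-order remainder is at most C (y - x)^2 with C independent of
    n, a closed condition. Pointwise convergence of v and dv is then enough to differentiate the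
    limit. *)
Lemma first_order_limit (v dv : nat -> R -> R) (w dw : R -> R) (a b C : R) :
  (forall n x, a <= x <= b -> is_derive (v n) x (dv n x)) ->
  (forall n, lipschitz_between a b (dv n) C) ->
  (forall x, a <= x <= b -> is_lim_seq (fun n => v n x) (w x)) ->
  (forall x, a <= x <= b -> is_lim_seq (fun n => dv n x) (dw x)) ->
  0 <= C ->
  forall x y, a <= x <= b -> a <= y <= b ->
    Rabs (w y - w x - dw x * (y - x)) <= C * (y - x) ^ 2.
Proof.
intros Hv HC Hw Hdw C0 x y Hx Hy.
apply (is_lim_seq_le (fun n => Rabs (v n y - v n x - dv n x * (y - x)))
  (fun _ => C * (y - x) ^ 2)
  (Rabs (w y - w x - dw x * (y - x))) (C * (y - x) ^ 2)).
- intros n.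
  assert (Hmin := Rmin_glb _ _ _ (proj1 Hx) (proj1 Hy)).
  assert (Hmax := Rmax_lub _ _ _ (proj2 Hx) (proj2 Hy)).
  destruct (MVT_gen (v n) x y (dv n)) as [c [Hc E]].
  + intros z Hz; apply Hv.
    lra.
  + intros z Hz; apply (is_derive_continuity_pt _ _ (dv n z)), Hv.
    lra.
  + assert (Hc1 : a <= c <= b) by lra.
    assert (Hcx : Rabs (c - x) <= Rabs (y - x)).
    { revert Hc; unfold Rmin, Rmax; destruct (Rle_dec x y); intros; split_Rabs; lra. }
    rewrite E; replace (dv n c * (y - x) - dv n x * (y - x))
      with ((dv n c - dv n x) * (y - x)) by ring.
    rewrite Rabs_mult, <- (pow2_abs (y - x)).
    assert (H := HC n c x Hc1 Hx).
    assert (H0 := Rabs_pos (y - x)).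
    replace (C * Rabs (y - x) ^ 2) with (C * Rabs (y - x) * Rabs (y - x)) by ring.
    apply Rmult_le_compat_r; [easy|]; nra.
- apply (is_lim_seq_abs _ (w y - w x - dw x * (y - x))).
  apply is_lim_seq_minus'; [apply is_lim_seq_minus'; auto|].
  apply is_lim_seq_mult'; [auto|apply is_lim_seq_const].
- apply is_lim_seq_const.
Qed.

Lemma first_order_D_in (w dw : R -> R) (a C x : R) :
  0 <= C ->
  (forall y, a <= y <= 1 -> Rabs (w y - w x - dw x * (y - x)) <= C * (y - x) ^ 2) ->
  a < x <= 1 -> D_in w dw Ioc01 x.
Proof.
intros C0 H Hx eps Heps.
assert (He : 0 < eps / (C + 1)) by (apply Rdiv_lt_0_compat; lra).
(* [x - a] keeps y in [a,1], where the quadratic bound holds. *)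
exists (Rmin (x - a) (eps / (C + 1))); split; [apply Rmin_glb_lt; lra|].
intros y [[Hy Hne] Hd]; simpl in Hd |- *; unfold Rdist, Ioc01 in *.
assert (Hd1 := Rmin_l (x - a) (eps / (C + 1))).
assert (Hd2 := Rmin_r (x - a) (eps / (C + 1))).
specialize (H y ltac:(split_Rabs; lra)).
assert (Hyx : 0 < Rabs (y - x)) by (apply Rabs_pos_lt; lra).
replace ((w y - w x) / (y - x) - dw x)
  with ((w y - w x - dw x * (y - x)) / (y - x)) by (field; lra).
rewrite Rabs_div by lra.
rewrite <- (pow2_abs (y - x)) in H.
assert (Hd3 : Rabs (y - x) * (C + 1) < eps).
{ apply Rlt_le_trans with (eps / (C + 1) * (C + 1)); [|right; field; lra].
  apply Rmult_lt_compat_r; lra. }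
apply Rle_lt_trans with (C * Rabs (y - x)); [|nra].
apply Rmult_le_reg_r with (Rabs (y - x)); [easy|].
unfold Rdiv; rewrite Rmult_assoc, Rinv_l by lra; lra.
Qed.

Lemma lipschitz_continue_in (w : R -> R) (a L x : R) :
  lipschitz_between a 1 w L -> 0 <= L -> a < x <= 1 -> continue_in w Ioc01 x.
Proof.
intros H L0 Hx eps Heps.
assert (He : 0 < eps / (L + 1)) by (apply Rdiv_lt_0_compat; lra).
exists (Rmin (x - a) (eps / (L + 1))); split; [apply Rmin_glb_lt; lra|].
intros y [[Hy _] Hd]; simpl in *; unfold Rdist, Ioc01 in *.
assert (Hd1 := Rmin_l (x - a) (eps / (L + 1))).
assert (Hd2 := Rmin_r (x - a) (eps / (L + 1))).
specialize (H y x ltac:(split_Rabs; lra) ltac:(lra)).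
assert (Hd3 : Rabs (y - x) * (L + 1) < eps).
{ apply Rlt_le_trans with (eps / (L + 1) * (L + 1)); [|right; field; lra].
  apply Rmult_lt_compat_r; lra. }
assert (H0 := Rabs_pos (y - x)); nra.
Qed.

(** * Subsequences and compact subsets of (0,1] *)

Lemma extraction_eventually (phi : nat -> nat) :
  extraction phi -> filterlim phi eventually eventually.
Proof.
intros H P [N HN]; exists N; intros n Hn; apply HN.
assert (Hle : forall k, (k <= phi k)%nat).
{ induction k as [|k IH]; [lia|]; specialize (H k); lia. }
specialize (Hle n); lia.
Qed.

(** [Bolzano_Weierstrass] provides a cluster value. Choice turns it into indices within 1 / (n + 1)
    of that value, and asking for an index at least [S (phi k)] makes them strictly increasing. *)
Lemma bounded_subsequence (x : nat -> R) (B : R) :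
  (forall n, Rabs (x n) <= B) ->
  exists phi (l : R), extraction phi /\ is_lim_seq (fun n => x (phi n)) l.
Proof.
intros HB.
destruct (Bolzano_Weierstrass x (fun c => - B <= c <= B)) as [l Hl].
{ apply compact_P3. }
{ intros n; apply Rabs_le_between, HB. }
assert (Hg : forall kN : nat * nat,
  exists m, (snd kN <= m)%nat /\ Rabs (x m - l) < / (INR (fst kN) + 1)).
{ intros [k N]; simpl.
  assert (Hk : 0 < / (INR k + 1)).
  { apply Rinv_0_lt_compat; assert (H := pos_INR k); lra. }
  apply (Hl (fun y => Rabs (y - l) < / (INR k + 1)) N).
  exists (mkposreal _ Hk); intros y Hy; exact Hy. }
apply functional_choice in Hg; destruct Hg as [g Hg].
set (phi := fix phi n := match n with
  | O => g (O, O) | S k => g (S k, S (phi k)) end).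
exists phi, l; split.
{ intros n; simpl; apply (Hg (S n, S (phi n))). }
apply is_lim_seq_spec; intros eps.
destruct (archimed_cor1 eps (cond_pos eps)) as [N [HN HN0]].
exists N; intros n Hn.
assert (H : Rabs (x (phi n) - l) < / (INR n + 1)).
{ destruct n; [apply (Hg (O, O))|apply (Hg (S n, S (phi n)))]. }
apply Rlt_trans with (1 := H); apply Rle_lt_trans with (2 := HN).
apply lt_INR in HN0; simpl in HN0; apply le_INR in Hn.
apply Rinv_le_contravar; lra.
Qed.

Lemma compact_Ioc01 (K : R -> Prop) :
  compact K -> included K Ioc01 ->
  exists d, 0 < d < 1 /\ forall x, K x -> d <= x <= 1.
Proof.
intros HK HI.
assert (H0 : complementary K 0).
{ intros H; apply HI in H; unfold Ioc01 in H; lra. }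
destruct (compact_P2 K HK 0 H0) as [[d d0] Hd].
(* The cap 1/2 ensures d < 1, so that - ln d is positive where the bound is used with lam tending to
   infinity. *)
exists (Rmin d (/ 2)); split.
{ split; [apply Rmin_glb_lt; lra|]; assert (H := Rmin_r d (/ 2)); lra. }
intros x Hx; assert (Hx' := HI x Hx); unfold Ioc01 in Hx'.
split; [|easy]; destruct (Rle_lt_dec (Rmin d (/ 2)) x) as [|Hlt]; [easy|].
exfalso; apply (Hd x); [|easy].
unfold disc; simpl; assert (H := Rmin_l d (/ 2)); split_Rabs; lra.
Qed.

(** * Compactness of radial solutions with bounded flux *)

(** It supplies the constant independent of n in [first_order_limit], for U as well as for V. As f
    is only Lipschitz, V' is estimated by differences instead of a third derivative. *)
Lemma radial_equilipschitz (f : R -> R) d Lam E :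
  (forall t, 0 <= t -> 0 <= f t) -> loc_lipschitz f -> 0 < d -> 0 <= E ->
  exists C, 0 <= C /\ forall lam U V,
    0 < lam <= Lam -> radial f lam U V -> flux V 1 <= E ->
    lipschitz_between d 1 V C /\
    lipschitz_between d 1 (fun r => - V r / r - lam * f (U r)) C.
Proof.
intros f0 Hf d0 E0.
destruct (Rlt_le_dec Lam 0) as [HLam|HLam].
{ exists 0; split; [lra|]; intros; lra. }
set (M := E * - ln d).
destruct (Hf M) as [L [L0 HL]].
destruct (loc_lipschitz_bounded f Hf M) as [B [B0 HB]].
(* [C1] bounds V, [C2] bounds V' through the equation, and [C3] is a Lipschitz constant of V', with
   one summand for each of V / r, 1 / r and f(U). *)
set (C1 := E / d).
set (C2 := C1 / d + Lam * B).
set (C3 := C2 / d + C1 / d ^ 2 + Lam * (L * C1)).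
assert (C10 : 0 <= C1) by (apply Rdiv_le_0_compat; lra).
assert (C1d : 0 <= C1 / d) by (apply Rdiv_le_0_compat; lra).
assert (C20 : 0 <= C2) by (unfold C2; nra).
assert (C30 : 0 <= C3).
{ unfold C3; assert (0 <= C2 / d) by (apply Rdiv_le_0_compat; lra).
  assert (0 <= C1 / d ^ 2) by (apply Rdiv_le_0_compat; nra).
  assert (0 <= L * C1) by nra; nra. }
exists (C2 + C3); split; [lra|]; intros lam U V Hlam HR HE.
assert (HV : forall r, d <= r <= 1 -> Rabs (V r) <= C1).
{ intros r Hr; apply Rle_trans with (flux V 1 / d).
  - apply (radial_abs_V_le f lam U V); easy || lra.
  - apply Rmult_le_compat_r; [left; apply Rinv_0_lt_compat|]; lra. }
assert (HU : forall r, d <= r <= 1 -> 0 <= U r <= M).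
{ intros r Hr; split; [apply HR; lra|]; apply Rle_trans with (flux V 1 * - ln d).
  - apply (radial_le_log f lam U V); easy || lra.
  - apply Rmult_le_compat_r; [|lra].
    assert (H : ln d <= ln 1) by (apply ln_le; lra); rewrite ln_1 in H; lra. }
assert (HUL : lipschitz_between d 1 U C1).
{ apply lipschitz_derive with V.
  - intros x Hx; apply (is_derive_continuity_pt _ _ (V x)), HR; lra.
  - intros x Hx; apply HR; lra.
  - intros x Hx; apply HV; lra. }
assert (HVL : lipschitz_between d 1 V C2).
{ apply lipschitz_derive with (fun r => - V r / r - lam * f (U r)).
  - intros x Hx; apply (radial_V_continuity _ _ _ _ HR); lra.
  - intros x Hx; apply HR; lra.
  - intros x Hx; unfold C2; apply Rle_trans with (1 := Rabs_triang _ _).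
    rewrite Rabs_Ropp; apply Rplus_le_compat.
    + unfold Rdiv; rewrite Rabs_mult, Rabs_Ropp, Rabs_inv, (Rabs_pos_eq x) by lra.
      apply Rmult_le_compat; [apply Rabs_pos| |apply HV; lra|].
      * left; apply Rinv_0_lt_compat; lra.
      * apply Rinv_le_contravar; lra.
    + rewrite Rabs_mult, (Rabs_pos_eq lam) by lra.
      apply Rmult_le_compat; [lra|apply Rabs_pos|lra|].
      apply HB, HU; lra. }
split; intros x y Hx Hy; assert (Hxy := Rabs_pos (x - y)).
{ assert (H := HVL x y Hx Hy); nra. }
apply Rle_trans with (C3 * Rabs (x - y)); [|nra].
replace (- V x / x - lam * f (U x) - (- V y / y - lam * f (U y)))
  with ((V y - V x) / x + (V y * (x - y) / (x * y) + lam * (f (U y) - f (U x))))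
  by (field; lra).
unfold C3; rewrite Rplus_assoc, Rmult_plus_distr_r.
apply Rle_trans with (1 := Rabs_triang _ _); apply Rplus_le_compat.
{ unfold Rdiv; rewrite Rabs_mult, Rabs_inv, (Rabs_pos_eq x) by lra.
  rewrite (Rmult_comm C2), Rmult_assoc, (Rmult_comm (/ d)), (Rmult_comm _ (/ x)).
  rewrite (Rmult_comm (/ x)); apply Rmult_le_compat.
  - apply Rabs_pos.
  - left; apply Rinv_0_lt_compat; lra.
  - rewrite Rabs_minus_sym; auto.
  - apply Rinv_le_contravar; lra. }
rewrite Rmult_plus_distr_r.
apply Rle_trans with (1 := Rabs_triang _ _); apply Rplus_le_compat.
{ unfold Rdiv; rewrite !Rabs_mult, Rabs_inv, (Rabs_pos_eq (x * y)) by nra.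
  rewrite Rmult_assoc, (Rmult_comm (Rabs (x - y))), <- Rmult_assoc.
  apply Rmult_le_compat_r; [easy|]; apply Rmult_le_compat.
  - apply Rabs_pos.
  - left; apply Rinv_0_lt_compat; nra.
  - auto.
  - apply Rinv_le_contravar; nra. }
rewrite Rabs_mult, (Rabs_pos_eq lam), Rmult_assoc by lra.
apply Rmult_le_compat; [lra|apply Rabs_pos|lra|].
rewrite Rabs_minus_sym; apply Rle_trans with (L * Rabs (U x - U y)).
- apply HL; auto.
- rewrite Rmult_assoc; apply Rmult_le_compat_l; auto.
Qed.

Lemma ex_lim_of_bound (x a b : nat -> R) (la lb K : R) :
  0 <= K -> is_lim_seq a la -> is_lim_seq b lb ->
  (forall n m, Rabs (x n - x m) <= K * (Rabs (a n - a m) + Rabs (b n - b m))) ->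
  ex_finite_lim_seq x.
Proof.
intros K0 Ha Hb H; apply ex_lim_seq_cauchy_corr; intros eps.
apply is_lim_seq_spec in Ha, Hb.
assert (He : 0 < eps / (4 * (K + 1))).
{ apply Rdiv_lt_0_compat; [apply cond_pos|lra]. }
destruct (Ha (mkposreal _ He)) as [N1 H1]; destruct (Hb (mkposreal _ He)) as [N2 H2].
simpl in H1, H2; set (eta := eps / (4 * (K + 1))) in *.
assert (E : eps = 4 * (K + 1) * eta :> R) by (unfold eta; field; lra).
exists (N1 + N2)%nat; intros n m Hn Hm.
assert (Hn1 := H1 n ltac:(lia)); assert (Hm1 := H1 m ltac:(lia)).
assert (Hn2 := H2 n ltac:(lia)); assert (Hm2 := H2 m ltac:(lia)).
apply Rle_lt_trans with (1 := H n m); rewrite E.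
assert (Hab : Rabs (a n - a m) + Rabs (b n - b m) <= 4 * eta)
  by (split_Rabs; lra).
nra.
Qed.

(** Letting m tend to infinity keeps the rate. With a [K] that does not depend on r, this is where
    uniform convergence comes from. *)
Lemma lim_bound (x a b : nat -> R) (lx la lb K : R) :
  is_lim_seq x lx -> is_lim_seq a la -> is_lim_seq b lb ->
  (forall n m, Rabs (x n - x m) <= K * (Rabs (a n - a m) + Rabs (b n - b m))) ->
  forall n, Rabs (x n - lx) <= K * (Rabs (a n - la) + Rabs (b n - lb)).
Proof.
intros Hx Ha Hb H n.
apply (is_lim_seq_le (fun m => Rabs (x n - x m))
  (fun m => K * (Rabs (a n - a m) + Rabs (b n - b m)))
  (Rabs (x n - lx)) (K * (Rabs (a n - la) + Rabs (b n - lb)))); [apply H|..].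
- apply (is_lim_seq_abs _ (x n - lx)), is_lim_seq_minus';
    [apply is_lim_seq_const|easy].
- apply is_lim_seq_mult'; [apply is_lim_seq_const|]; apply is_lim_seq_plus'.
  + apply (is_lim_seq_abs _ (a n - la)), is_lim_seq_minus';
      [apply is_lim_seq_const|easy].
  + apply (is_lim_seq_abs _ (b n - lb)), is_lim_seq_minus';
      [apply is_lim_seq_const|easy].
Qed.

Lemma loc_lipschitz_lim (f : R -> R) (x : nat -> R) (l : R) :
  loc_lipschitz f -> (forall n, 0 <= x n) -> is_lim_seq x l ->
  is_lim_seq (fun n => f (x n)) (f l).
Proof.
intros Hf x0 Hx.
assert (l0 : 0 <= l).
{ apply (is_lim_seq_le (fun _ => 0) x 0 l); auto using is_lim_seq_const. }
apply is_lim_seq_ext with (fun n => f (Rmax 0 (x n))).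
{ intros n; now rewrite Rmax_right. }
rewrite <- (Rmax_right 0 l) by easy.
apply (is_lim_seq_continuous (fun t => f (Rmax 0 t))); [|easy].
now apply loc_lipschitz_continuous.
Qed.

(** The limits exist pointwise by the Cauchy estimate, and the last clause gives a common rate on
    each [d,1]. The second derivative needs no limit argument of its own: the equation expresses it
    through the limits of U and V. *)
Lemma radial_compactness (f : R -> R) (lam : nat -> R) (U V : nat -> R -> R)
  (l e E Lam : R) :
  (forall t, 0 <= t -> 0 <= f t) -> loc_lipschitz f ->
  (forall n, 0 < lam n <= Lam) -> (forall n, radial f (lam n) (U n) (V n)) ->
  (forall n, flux (V n) 1 <= E) ->
  is_lim_seq lam l -> is_lim_seq (fun n => V n 1) e ->
  exists us dus : R -> R,
    is_C2_on Ioc01 us dus (fun r => - dus r / r - l * f (us r)) /\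
    (forall r, 0 < r <= 1 -> is_lim_seq (fun n => U n r) (us r)) /\
    (forall r, 0 < r <= 1 -> is_lim_seq (fun n => V n r) (dus r)) /\
    (forall d, 0 < d -> exists K, forall n r, d <= r <= 1 ->
      Rabs (U n r - us r) <= K * (Rabs (V n 1 - e) + Rabs (lam n - l)) /\
      Rabs (V n r - dus r) <= K * (Rabs (V n 1 - e) + Rabs (lam n - l)) /\
      Rabs ((- V n r / r - lam n * f (U n r)) - (- dus r / r - l * f (us r))) <=
        K * (Rabs (V n 1 - e) + Rabs (lam n - l))).
Proof.
intros f0 Hf Hlam HR HE Hl He.
assert (E0 : 0 <= E).
{ apply Rle_trans with (2 := HE 0%nat).
  apply (radial_flux_ge0 f (lam 0%nat) (U 0%nat)); auto; [apply Hlam|lra]. }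
assert (l0 : 0 <= l <= Lam).
{ split.
  - apply (is_lim_seq_le (fun _ => 0) lam 0 l); auto using is_lim_seq_const.
    intros n; left; apply Hlam.
  - apply (is_lim_seq_le lam (fun _ => Lam) l Lam); auto using is_lim_seq_const.
    intros n; apply Hlam. }
assert (HM : forall d r n, 0 < d -> d <= r <= 1 -> 0 <= U n r <= E * - ln d).
{ intros d r n d0 Hr; split; [apply (HR n); lra|].
  apply Rle_trans with (flux (V n) 1 * - ln d).
  - apply (radial_le_log f (lam n) (U n)); auto; apply Hlam.
  - apply Rmult_le_compat_r; [|apply HE].
    assert (H : ln d <= ln 1) by (apply ln_le; lra); rewrite ln_1 in H; lra. }
assert (Hst : forall d, 0 < d -> exists K, 0 <= K /\ forall n m r, d <= r <= 1 ->
  Rabs (U n r - U m r) <= K * (Rabs (V n 1 - V m 1) + Rabs (lam n - lam m)) /\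
  Rabs (V n r - V m r) <= K * (Rabs (V n 1 - V m 1) + Rabs (lam n - lam m))).
{ intros d d0.
  destruct (radial_stability f d (E * - ln d) Lam Hf d0) as [K [K0 HK]].
  exists K; split; [easy|]; intros n m r Hr; apply HK; auto.
  - destruct (Hlam n); lra.
  - intros s Hs; split; apply HM; auto. }
(* Outside (0,1] the limit may fail to exist and [real (Lim_seq _)] is a default value; only (0,1]
   is ever used. *)
set (us := fun r => real (Lim_seq (fun n => U n r))).
set (dus := fun r => real (Lim_seq (fun n => V n r))).
set (ddus := fun r => - dus r / r - l * f (us r)).
assert (HU : forall r, 0 < r <= 1 -> is_lim_seq (fun n => U n r) (us r)).
{ intros r Hr; apply Lim_seq_correct'.
  destruct (Hst r (proj1 Hr)) as [K [K0 HK]].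
  apply (ex_lim_of_bound _ (fun n => V n 1) lam e l K); auto.
  intros n m; apply HK; lra. }
assert (HV : forall r, 0 < r <= 1 -> is_lim_seq (fun n => V n r) (dus r)).
{ intros r Hr; apply Lim_seq_correct'.
  destruct (Hst r (proj1 Hr)) as [K [K0 HK]].
  apply (ex_lim_of_bound _ (fun n => V n 1) lam e l K); auto.
  intros n m; apply HK; lra. }
assert (HddV : forall r, 0 < r <= 1 ->
  is_lim_seq (fun n => - V n r / r - lam n * f (U n r)) (ddus r)).
{ intros r Hr; apply is_lim_seq_minus'.
  - apply is_lim_seq_mult'; [|apply is_lim_seq_const].
    apply (is_lim_seq_opp _ (dus r)), HV, Hr.
  - apply is_lim_seq_mult'; [easy|].
    apply loc_lipschitz_lim; auto; intros n; apply (HR n); lra. }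
exists us, dus; fold ddus; split; [|split; [easy|split; [easy|]]].
(* Differentiability is local, so x is placed strictly inside [x/2, 1], where the uniform Lipschitz
   constants are available. *)
- intros x Hx; unfold Ioc01 in Hx; set (a := x / 2).
  destruct (radial_equilipschitz f a Lam E) as [C [C0 HC]]; auto; [unfold a; lra|].
  assert (Ha : forall y, a <= y <= 1 -> 0 < y <= 1) by (unfold a; intros; lra).
  assert (Hax : a < x <= 1) by (unfold a; lra).
  assert (HVC := fun n => proj1 (HC _ _ _ (Hlam n) (HR n) (HE n))).
  assert (HWC := fun n => proj2 (HC _ _ _ (Hlam n) (HR n) (HE n))).
  split; [|split].
  + apply (first_order_D_in us dus a C x); auto.
    intros y Hy; apply (first_order_limit U V us dus a 1 C); auto; [|lra].
    intros n z Hz; apply (HR n); apply Ha in Hz; lra.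
  + apply (first_order_D_in dus ddus a C x); auto.
    intros y Hy; apply (first_order_limit V
      (fun n r => - V n r / r - lam n * f (U n r)) dus ddus a 1 C); auto; [|lra].
    intros n z Hz; apply (HR n); apply Ha in Hz; lra.
  + apply (lipschitz_continue_in ddus a C); auto.
    apply (lipschitz_limit (fun n r => - V n r / r - lam n * f (U n r))); auto.
- intros d d0; destruct (Hst d d0) as [K [K0 HK]].
  set (M := E * - ln d).
  destruct (Hf M) as [L [L0 HL]].
  destruct (loc_lipschitz_bounded f Hf M) as [B [B0 HB]].
  (* [K] serves U and V; the bracket serves V', its terms coming from V / r, from lam n - l, and
     from f(U n) - f(us). *)
  exists (K + (K / d + B + Lam * (L * K))); intros n r Hr.
  assert (Kd : 0 <= K / d) by (apply Rdiv_le_0_compat; lra).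
  assert (LK : 0 <= L * K) by nra.
  assert (Hr' : 0 < r <= 1) by lra.
  set (S := Rabs (V n 1 - e) + Rabs (lam n - l)).
  assert (S0 : 0 <= S).
  { apply Rplus_le_le_0_compat; apply Rabs_pos. }
  assert (H1 : Rabs (U n r - us r) <= K * S).
  { apply (lim_bound (fun n => U n r) (fun n => V n 1) lam); auto.
    intros p q; apply HK, Hr. }
  assert (H2 : Rabs (V n r - dus r) <= K * S).
  { apply (lim_bound (fun n => V n r) (fun n => V n 1) lam); auto.
    intros p q; apply HK, Hr. }
  assert (H3 : 0 <= (K / d + B + Lam * (L * K)) * S) by (apply Rmult_le_pos; nra).
  assert (H4 : 0 <= K * S) by nra.
  split; [lra|split; [lra|]].
  apply Rle_trans with ((K / d + B + Lam * (L * K)) * S); [|lra].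
  assert (HMs : 0 <= us r <= M).
  { split.
    - apply (is_lim_seq_le (fun _ => 0) (fun n => U n r) 0 (us r));
        auto using is_lim_seq_const.
      intros m; apply (HM d r m); auto.
    - apply (is_lim_seq_le (fun n => U n r) (fun _ => M) (us r) M);
        auto using is_lim_seq_const.
      intros m; apply (HM d r m); auto. }
  replace (- V n r / r - lam n * f (U n r) - (- dus r / r - l * f (us r)))
    with (- ((V n r - dus r) / r) - ((lam n - l) * f (U n r) +
          l * (f (U n r) - f (us r)))) by (field; lra).
  assert (J1 : Rabs ((V n r - dus r) / r) <= K / d * S).
  { unfold Rdiv; rewrite Rabs_mult, Rabs_inv, (Rabs_pos_eq r) by lra.
    rewrite Rmult_assoc, (Rmult_comm (/ d)), <- Rmult_assoc.
    apply Rmult_le_compat; [apply Rabs_pos| |easy|].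
    - left; apply Rinv_0_lt_compat; lra.
    - apply Rinv_le_contravar; lra. }
  assert (J2 : Rabs ((lam n - l) * f (U n r)) <= B * S).
  { rewrite Rabs_mult, Rmult_comm; apply Rmult_le_compat; try apply Rabs_pos.
    - apply HB, HM; auto.
    - unfold S; assert (H := Rabs_pos (V n 1 - e)); lra. }
  assert (J3 : Rabs (l * (f (U n r) - f (us r))) <= Lam * (L * K) * S).
  { rewrite Rabs_mult, (Rabs_pos_eq l), Rmult_assoc by lra.
    apply Rmult_le_compat; [lra|apply Rabs_pos|lra|].
    apply Rle_trans with (L * Rabs (U n r - us r)).
    - apply HL; auto; apply HM; auto.
    - rewrite Rmult_assoc; apply Rmult_le_compat_l; auto. }
  split_Rabs; lra.
Qed.

Lemma unif_cv_of_bound (K : R -> Prop) (v : nat -> R -> R) (w : R -> R)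
  (s : nat -> R) (C : R) :
  is_lim_seq s 0 -> (forall n x, K x -> Rabs (v n x - w x) <= C * s n) ->
  unif_cv_on K v w.
Proof.
intros Hs H eps Heps.
assert (HCs : is_lim_seq (fun n => C * s n) (C * 0)).
{ apply is_lim_seq_mult'; [apply is_lim_seq_const|easy]. }
rewrite Rmult_0_r in HCs; apply is_lim_seq_spec in HCs.
destruct (HCs (mkposreal _ Heps)) as [N HN]; exists N; intros n Hn x Hx.
specialize (HN n Hn); simpl in HN; rewrite Rminus_0_r in HN.
assert (H1 := H n x Hx); assert (H2 := Rle_abs (C * s n)); lra.
Qed.

(** * Consequences of the Pohozaev inequality *)

(** With eps = 1 the inequality reads E^2 <= 4 E + 2 C lam, which excludes E > 4 + C Lam. The bound
    does not involve the value of [U] at 0. *)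
Lemma radial_flux_bounded (f : R -> R) (Lam : R) :
  (forall t, 0 <= t -> 0 <= f t) -> loc_lipschitz f -> fast_growing f ->
  exists E, forall lam U V, 0 < lam <= Lam -> radial f lam U V -> flux V 1 <= E.
Proof.
intros f0 Hf Hg.
destruct (loc_lipschitz_primitive f Hf) as [F [F0 HF]].
destruct (fast_growing_primitive f F 1 f0 Hg F0 HF Rlt_0_1) as [C [C0 HC]].
exists (4 + C * Lam); intros lam U V Hlam HR.
assert (H := radial_pohozaev f F lam U V 1 C f0 (proj1 Hlam) HR F0 HF HC).
assert (C * lam <= C * Lam) by nra.
assert (0 <= C * Lam) by nra; nra.
Qed.

Lemma radial_flux_to_0 (f : R -> R) (lam : nat -> R) (U V : nat -> R -> R) :
  (forall t, 0 <= t -> 0 <= f t) -> loc_lipschitz f -> fast_growing f ->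
  (forall n, 0 < lam n) -> (forall n, radial f (lam n) (U n) (V n)) ->
  is_lim_seq lam 0 -> is_lim_seq (fun n => flux (V n) 1) 0.
Proof.
intros f0 Hf Hg Hlam HR Hl.
destruct (loc_lipschitz_primitive f Hf) as [F [F0 HF]].
apply is_lim_seq_spec; intros [eps Heps]; simpl.
(* With this choice E^2 / 2 <= (eps / 4) E + C lam. If E >= eps, then E^2 <= 4 C lam, contradicting
   lam < eps^2 / (4 C + 1); the added 1 covers C = 0. *)
destruct (fast_growing_primitive f F (eps / 8) f0 Hg F0 HF ltac:(lra))
  as [C [C0 HC]].
assert (Hd : 0 < eps ^ 2 / (4 * C + 1)) by (apply Rdiv_lt_0_compat; nra).
apply is_lim_seq_spec in Hl.
destruct (Hl (mkposreal _ Hd)) as [N HN]; exists N; intros n Hn.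
specialize (HN n Hn); simpl in HN; rewrite Rminus_0_r in HN.
assert (H := radial_pohozaev f F (lam n) (U n) (V n) _ C f0 (Hlam n) (HR n) F0 HF HC).
assert (HE : 0 <= flux (V n) 1)
  by (apply (radial_flux_ge0 f (lam n) (U n)); auto; lra).
rewrite Rabs_pos_eq in HN by (left; apply Hlam).
rewrite Rminus_0_r, Rabs_pos_eq by easy.
apply (Rmult_lt_compat_r (4 * C + 1)) in HN; [|lra].
replace (eps * (eps * 1) / (4 * C + 1) * (4 * C + 1)) with (eps ^ 2) in HN
  by (field; lra).
assert (Hln := Hlam n).
destruct (Rlt_le_dec (flux (V n) 1) eps) as [|Hc]; [easy|exfalso].
assert (Hc2 : eps * flux (V n) 1 <= flux (V n) 1 ^ 2) by nra.
assert (Hc3 : eps ^ 2 <= flux (V n) 1 ^ 2) by (apply pow_incr; lra).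
nra.
Qed.

(** * Positivity and integrability for the limit *)

Lemma is_derive_locally_0 (g : R -> R) (a b x l : R) :
  (forall y, a < y < b -> g y = 0) -> a < x < b -> is_derive g x l -> l = 0.
Proof.
intros Hg Hx Hl.
assert (H : is_derive (fun _ => 0) x l).
{ apply is_derive_ext_loc with g; [|easy].
  assert (Hd : 0 < Rmin (x - a) (b - x)) by (apply Rmin_glb_lt; lra).
  exists (mkposreal _ Hd); intros y Hy.
  unfold ball in Hy; simpl in Hy; unfold AbsRing_ball, abs, minus, plus, opp in Hy;
    simpl in Hy.
  apply Hg; assert (H1 := Rmin_l (x - a) (b - x)).
  assert (H2 := Rmin_r (x - a) (b - x)); split_Rabs; lra. }
apply is_derive_unique in H; rewrite Derive_const in H; easy.
Qed.

(** A zero at r < 1 would spread: by monotonicity [us] vanishes on (r,1), hence so do its two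
    derivatives, and the equation reduces to l f(0) = 0. *)
Lemma C2_on_positive (f : R -> R) (l : R) (us dus : R -> R) :
  0 < l -> 0 < f 0 ->
  is_C2_on Ioc01 us dus (fun r => - dus r / r - l * f (us r)) ->
  (forall r, 0 < r <= 1 -> 0 <= us r) ->
  (forall x y, 0 < x -> x <= y -> y <= 1 -> us y <= us x) ->
  forall r, 0 < r < 1 -> 0 < us r.
Proof.
intros l0 f0 HC us0 Hdec r Hr.
destruct (us0 r ltac:(lra)) as [|E]; [easy|exfalso].
assert (HD : forall y, r < y < 1 -> Ioc01 y) by (unfold Ioc01; intros; lra).
assert (Hus : forall y, r < y < 1 -> us y = 0).
{ intros y Hy; assert (H := Hdec r y ltac:(lra) ltac:(lra) ltac:(lra)).
  assert (H1 := us0 y ltac:(lra)); lra. }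
assert (Hdus : forall y, r < y < 1 -> dus y = 0).
{ intros y Hy; apply (is_derive_locally_0 us r 1 y); auto.
  apply (D_in_is_derive us dus Ioc01 r 1); auto; apply HC; auto. }
set (m := (r + 1) / 2).
assert (Hm : r < m < 1) by (unfold m; lra).
assert (H : - dus m / m - l * f (us m) = 0).
{ apply (is_derive_locally_0 dus r 1 m); auto.
  apply (D_in_is_derive dus (fun r => - dus r / r - l * f (us r)) Ioc01 r 1); auto.
  apply HC; auto. }
rewrite Hdus, Hus in H by easy; unfold Rdiv in H; nra.
Qed.

(** The integral over [a,1] is the flux at 1 minus the flux at a. It grows as a decreases and is at
    most the flux at 1, so it converges to its supremum. *)
Lemma C2_on_integrable (f : R -> R) (l : R) (us dus : R -> R) :
  (forall t, 0 <= t -> 0 <= f t) -> loc_lipschitz f -> 0 <= l ->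
  is_C2_on Ioc01 us dus (fun r => - dus r / r - l * f (us r)) ->
  (forall r, 0 < r <= 1 -> 0 <= us r) ->
  (forall r, 0 < r <= 1 -> dus r <= 0) ->
  ex_RInt_gen (fun r => l * f (us r) * r) (at_right 0) (at_point 1).
Proof.
intros f0 Hf l0 HC us0 dus0.
assert (HI : forall a, 0 < a -> a < 1 ->
  is_RInt (fun r => l * f (us r) * r) a 1 (flux dus 1 - flux dus a) /\
  forall b, a <= b <= 1 -> flux dus a <= flux dus b).
{ intros a a0 a1.
  destruct (derivable_extension us dus a 1) as [Y HY]; [easy| |].
  { intros x Hx; apply D_in_imp with Ioc01; [unfold Ioc01; intros; lra|].
    apply HC; unfold Ioc01; lra. }
  destruct (derivable_extension dus (fun r => - dus r / r - l * f (us r)) a 1)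
    as [W HW]; [easy| |].
  { intros x Hx; apply D_in_imp with Ioc01; [unfold Ioc01; intros; lra|].
    apply HC; unfold Ioc01; lra. }
  assert (HE : forall b, a <= b <= 1 -> flux dus b = flux W b).
  { intros b Hb; unfold flux; now rewrite (proj1 (HW b Hb)). }
  (* The extension [Y] may become negative outside [a,1]; clamping keeps the integrand continuous at
     the endpoints. *)
  assert (HdE : forall x, a <= x <= 1 ->
    is_derive (flux W) x (l * f (Rmax 0 (Y x)) * x)).
  { intros x Hx; destruct (HW x Hx) as [E1 H1]; destruct (HY x Hx) as [E2 _].
    rewrite E2, Rmax_right by (apply us0; lra).
    unfold flux; auto_derive; [eexists; eassumption|].
    rewrite (is_derive_unique (fun x : R => W x) _ _ H1), E1; field; lra. }
  split.
  - apply is_RInt_ext with (fun x => l * f (Rmax 0 (Y x)) * x).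
    { rewrite Rmin_left, Rmax_right by lra; intros x Hx.
      rewrite (proj1 (HY x ltac:(lra))), Rmax_right; [easy|apply us0; lra]. }
    rewrite !HE by lra.
    apply (is_RInt_derive (flux W)); rewrite Rmin_left, Rmax_right by lra; [easy|].
    intros x Hx; apply continuity_pt_filterlim.
    apply continuity_pt_mult; [|apply derivable_continuous, derivable_id].
    apply continuity_pt_mult; [now apply continuity_pt_const|].
    apply (continuity_pt_comp Y (fun t => f (Rmax 0 t))).
    + apply (is_derive_continuity_pt _ _ (dus x)), HY, Hx.
    + now apply loc_lipschitz_continuous.
  - intros b Hb; rewrite !HE by lra.
    apply (derive_ge0_le (flux W) (fun x => l * f (Rmax 0 (Y x)) * x)); [lra|..].
    + intros x Hx; apply (is_derive_continuity_pt _ _ (l * f (Rmax 0 (Y x)) * x)).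
      apply HdE; lra.
    + intros x Hx; apply HdE; lra.
    + intros x Hx; apply Rmult_le_pos; [apply Rmult_le_pos; [easy|]|lra].
      apply f0, Rmax_l. }
assert (HE0 : forall r, 0 < r <= 1 -> 0 <= flux dus r).
{ intros r Hr; unfold flux; assert (H := dus0 r Hr); nra. }
destruct (completeness (fun y => exists a, 0 < a < 1 /\ y = flux dus 1 - flux dus a))
  as [m [Hub Hlub]].
- exists (flux dus 1); intros y [a [Ha ->]]; assert (H := HE0 a ltac:(lra)); lra.
- exists (flux dus 1 - flux dus (/ 2)), (/ 2); split; [lra|easy].
- exists m; intros P [eps HP].
  (* Otherwise m - eps would be a smaller upper bound. By monotonicity, one such a settles every
     lower limit x < a. *)
  destruct (Classical_Prop.classic
    (exists a, 0 < a < 1 /\ m - eps < flux dus 1 - flux dus a))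
    as [[a [Ha Hma]]|Hn].
  + apply Filter_prod with (fun x => 0 < x < a) (fun y => y = 1).
    * exists (mkposreal a (proj1 Ha)); intros y Hy Hy0.
      unfold ball in Hy; simpl in Hy;
        unfold AbsRing_ball, abs, minus, plus, opp in Hy; simpl in Hy.
      split_Rabs; lra.
    * easy.
    * intros x y Hx ->; exists (flux dus 1 - flux dus x).
      destruct (HI x ltac:(lra) ltac:(lra)) as [H1 H2]; split; [exact H1|].
      apply HP.
      assert (H3 := H2 a ltac:(lra)).
      assert (H4 : flux dus 1 - flux dus x <= m).
      { apply Hub; exists x; split; [lra|easy]. }
      unfold ball; simpl; unfold AbsRing_ball, abs, minus, plus, opp; simpl.
      split_Rabs; lra.
  + exfalso; assert (H : m <= m - eps).
    { apply Hlub; intros y [a [Ha ->]]; apply Rnot_lt_le; intros H.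
      apply Hn; now exists a. }
    assert (H1 := cond_pos eps); lra.
Qed.

(** * Bounded sequences and the trichotomy *)

Lemma lim_seq_finite_bounded (x : nat -> R) (l : R) :
  is_lim_seq x l -> exists B, forall n, x n <= B.
Proof.
intros H; destruct (filterlim_bounded (K := R_AbsRing) (V := R_NormedModule) x)
  as [B HB]; [now exists l|].
exists B; intros n; apply Rle_trans with (2 := HB n), Rle_abs.
Qed.

Lemma eventually_bounded (x : nat -> R) (N : nat) (B : R) :
  (forall n, (N <= n)%nat -> x n <= B) -> exists B', forall n, x n <= B'.
Proof.
revert B; induction N as [|N IH]; intros B H.
- exists B; intros n; apply H; lia.
- apply (IH (Rmax B (x N))); intros n Hn.
  destruct (Nat.eq_dec n N) as [->|]; [apply Rmax_r|].
  apply Rle_trans with B; [apply H; lia|apply Rmax_l].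
Qed.

Theorem theorem1p8 (p : R) (h dh : R -> R)
  (hp : 2 <= p)
  (h_C1 : is_C1_on Ici0 h dh)
  (h_ge0 : forall t, 0 <= t -> 0 <= h t)
  (h_pos : exists t0, 0 < t0 /\ forall t, t0 <= t -> 0 < h t)
  (h_lim : is_lim (fun t => dh t / (Rpower t (p - 1) * h t)) p_infty 0)
  (lam mu : nat -> R) (u : nat -> R -> R)
  (u_sol : forall n, is_solution (nonlin h p) (lam n) (mu n) (u n))
  (mu_lim : is_lim_seq mu p_infty)
  (lams : Rbar) (lams_ge0 : Rbar_le 0 lams)
  (lam_lim : is_lim_seq lam lams) :
  (exists phi : nat -> nat, extraction phi /\
    ((* (i) *)
     (lams = Finite 0 /\
      C2loc_cv Ioc01 (fun n => u (phi n)) (fun _ => 0))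
     \/
     (* (ii) *)
     (exists l : R, lams = Finite l /\ 0 < l /\
      exists us dus ddus : R -> R,
        is_C2_on Ioc01 us dus ddus /\
        (forall x y, 0 < x -> x <= y -> y <= 1 -> us y <= us x) /\
        C2loc_cv Ioc01 (fun n => u (phi n)) us /\
        (forall r, Ioc01 r ->
           - ddus r - / r * dus r = l * nonlin h p (us r)) /\
        (forall r, 0 < r < 1 -> 0 <= us r) /\
        us 1 = 0 /\
        ex_RInt_gen (fun r => l * nonlin h p (us r) * r)
          (at_right 0) (at_point 1) /\
        (0 < nonlin h p 0 -> forall r, 0 < r < 1 -> 0 < us r))
     \/
     (* (iii) *)
     (lams = p_infty /\ loc_unif_bounded Ioc01 (fun n => u (phi n)))))
  /\
  (Rbar_lt 0 (Glb_Rbar (fun y => exists t, 0 < t /\ y = nonlin h p t / t)) ->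
   forall phi : nat -> nat, extraction phi ->
     ~ (lams = p_infty /\ loc_unif_bounded Ioc01 (fun n => u (phi n)))).
Proof.
assert (Hf := nonlin_loc_lipschitz p h dh ltac:(lra) h_C1).
assert (Hg := nonlin_fast_growing p h dh hp h_C1 h_pos h_lim).
assert (f0 : forall t, 0 <= t -> 0 <= nonlin h p t).
{ intros t Ht; apply Rmult_le_pos; [auto|left; apply exp_pos]. }
set (f := nonlin h p) in *.
assert (Hlam : forall n, 0 < lam n) by (intros n; apply (u_sol n)).
(* Packing the four functions into one tuple lets a single use of choice fix them for all n. *)
assert (HX : forall n, exists X : (R -> R) * (R -> R) * (R -> R) * (R -> R),
  let '(du, ddu, U, V) := X in
  is_C2_on Icc01 (u n) du ddu /\
  (forall r, Ioc01 r -> ddu r = - du r / r - lam n * f (u n r)) /\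
  radial f (lam n) U V /\
  forall r, 0 <= r <= 1 -> U r = u n r /\ V r = du r).
{ intros n; destruct (solution_radial f _ _ _ (u_sol n)) as [du [ddu [U [V H]]]].
  now exists (du, ddu, U, V). }
apply functional_choice in HX; destruct HX as [X HX].
set (du := fun n => fst (fst (fst (X n)))).
set (ddu := fun n => snd (fst (fst (X n)))).
set (U := fun n => snd (fst (X n))).
set (V := fun n => snd (X n)).
assert (HX' : forall n, is_C2_on Icc01 (u n) (du n) (ddu n) /\
  (forall r, Ioc01 r -> ddu n r = - du n r / r - lam n * f (u n r)) /\
  radial f (lam n) (U n) (V n) /\
  forall r, 0 <= r <= 1 -> U n r = u n r /\ V n r = du n r).
{ intros n; unfold du, ddu, U, V; specialize (HX n).
  now destruct (X n) as [[[? ?] ?] ?]. }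
clearbody du ddu U V; clear X HX.
assert (HR : forall n, radial f (lam n) (U n) (V n)) by (intros n; apply (HX' n)).
assert (HUu : forall n r, 0 <= r <= 1 -> U n r = u n r /\ V n r = du n r)
  by (intros n; apply (HX' n)).
split.
- destruct lams as [l| |]; [|exists (fun n => n)|easy].
  + destruct (lim_seq_finite_bounded lam l lam_lim) as [Lam HLam].
    destruct (radial_flux_bounded f Lam f0 Hf Hg) as [E HE].
    assert (HEn : forall n, flux (V n) 1 <= E).
    { intros n; apply (HE (lam n) (U n)); auto. }
    assert (HE0 : forall n, 0 <= flux (V n) 1).
    { intros n; apply (radial_flux_ge0 f (lam n) (U n)); auto; lra. }
    (* The only extraction: at r = 1 the flux is - V, so the flux bounds control |V n 1|. *)
    destruct (bounded_subsequence (fun n => V n 1) E) as [phi [e [Hphi He]]].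
    { intros n; assert (H1 := HEn n); assert (H2 := HE0 n).
      unfold flux in *; split_Rabs; lra. }
    assert (Hlphi : is_lim_seq (fun n => lam (phi n)) l).
    { apply is_lim_seq_subseq; [now apply extraction_eventually|easy]. }
    destruct (radial_compactness f (fun n => lam (phi n)) (fun n => U (phi n))
      (fun n => V (phi n)) l e E Lam) as [us [dus [HC2 [HU [HV HK]]]]]; auto.
    assert (Hs : is_lim_seq
      (fun n => Rabs (V (phi n) 1 - e) + Rabs (lam (phi n) - l)) 0).
    { rewrite <- (Rplus_0_r 0); apply is_lim_seq_plus'.
      - rewrite <- Rabs_R0, <- (Rminus_diag e).
        apply (is_lim_seq_abs _ (e - e)), is_lim_seq_minus';
          [easy|apply is_lim_seq_const].
      - rewrite <- Rabs_R0, <- (Rminus_diag l).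
        apply (is_lim_seq_abs _ (l - l)), is_lim_seq_minus';
          [easy|apply is_lim_seq_const]. }
    assert (Hcv : forall K, compact K -> included K Ioc01 ->
      unif_cv_on K (fun n => u (phi n)) us /\
      unif_cv_on K (fun n => du (phi n)) dus /\
      unif_cv_on K (fun n => ddu (phi n)) (fun r => - dus r / r - l * f (us r))).
    { intros K Kc KI; destruct (compact_Ioc01 K Kc KI) as [d [Hd HKd]].
      destruct (HK d (proj1 Hd)) as [C HC].
      assert (HC' : forall n x, K x ->
        Rabs (u (phi n) x - us x) <=
          C * (Rabs (V (phi n) 1 - e) + Rabs (lam (phi n) - l)) /\
        Rabs (du (phi n) x - dus x) <=
          C * (Rabs (V (phi n) 1 - e) + Rabs (lam (phi n) - l)) /\
        Rabs (ddu (phi n) x - (- dus x / x - l * f (us x))) <=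
          C * (Rabs (V (phi n) 1 - e) + Rabs (lam (phi n) - l))).
      { intros n x Hx; assert (Hx' := HKd x Hx).
        destruct (HUu (phi n) x ltac:(lra)) as [E1 E2].
        rewrite (proj1 (proj2 (HX' (phi n)))) by (unfold Ioc01; lra).
        rewrite <- E1, <- E2; apply HC, Hx'. }
      split; [|split]; apply (unif_cv_of_bound _ _ _ _ C Hs); intros; now apply HC'. }
    assert (HC2n : forall n, is_C2_on Ioc01 (u (phi n)) (du (phi n)) (ddu (phi n))).
    { intros n x Hx; unfold Ioc01 in Hx.
      destruct (proj1 (HX' (phi n)) x) as [H1 [H2 H3]]; [unfold Icc01; lra|].
      assert (Hsub : forall y, Ioc01 y -> Icc01 y) by (unfold Ioc01, Icc01; intros; lra).
      split; [|split]; [exact (D_in_imp _ _ _ _ _ Hsub H1)|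
        exact (D_in_imp _ _ _ _ _ Hsub H2)|].
      intros eps Heps; destruct (H3 eps Heps) as [alp [Halp H4]].
      exists alp; split; [easy|]; intros y [[Hy Hne] Hyd]; apply H4.
      split; [split; auto|easy]. }
    assert (us0 : forall r, 0 < r <= 1 -> 0 <= us r).
    { intros r Hr; apply (is_lim_seq_le (fun _ => 0) (fun n => U (phi n) r) 0 (us r));
        auto using is_lim_seq_const.
      intros n; apply (HR (phi n)); lra. }
    assert (dus0 : forall r, 0 < r <= 1 -> dus r <= 0).
    { intros r Hr; apply (is_lim_seq_le (fun n => V (phi n) r) (fun _ => 0) (dus r) 0);
        auto using is_lim_seq_const.
      intros n; apply (radial_V_le0 f (lam (phi n)) (U (phi n))); auto. }
    exists phi; split; [easy|].
    destruct (Req_dec l 0) as [->|Hl0]; [left|right; left].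
    * split; [easy|].
      assert (HF0 : is_lim_seq (fun n => flux (V (phi n)) 1) 0).
      { apply (radial_flux_to_0 f (fun n => lam (phi n)) (fun n => U (phi n))); auto. }
      (* The flux at 1 tends to 0 with lam, and it controls U by [radial_le_log] and V by
         [radial_abs_V_le], for each fixed r. *)
      assert (Hus : forall r, 0 < r <= 1 -> us r = 0).
      { intros r Hr; apply Rle_antisym; [|auto].
        rewrite <- (Rmult_0_l (- ln r)).
        apply (is_lim_seq_le (fun n => U (phi n) r)
          (fun n => flux (V (phi n)) 1 * - ln r) (us r) (0 * - ln r)); auto.
        - intros n; apply (radial_le_log f (lam (phi n)) (U (phi n))); auto; lra.
        - apply is_lim_seq_mult'; [easy|apply is_lim_seq_const]. }
      assert (Hdus : forall r, 0 < r <= 1 -> dus r = 0).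
      { intros r Hr; apply Rle_antisym; [auto|].
        assert (Rabs (dus r) <= 0 * / r); [|split_Rabs; lra].
        apply (is_lim_seq_le (fun n => Rabs (V (phi n) r))
          (fun n => flux (V (phi n)) 1 / r) (Rabs (dus r)) (0 * / r)).
        - intros n; apply (radial_abs_V_le f (lam (phi n)) (U (phi n))); auto; lra.
        - apply (is_lim_seq_abs _ (dus r)); auto.
        - apply is_lim_seq_mult'; [easy|apply is_lim_seq_const]. }
      (* The target is the constant 0, while [us] and [dus] are known to vanish only on (0,1]; the
         convergences are rewritten on each compact set. *)
      exists (fun n => du (phi n)), (fun n => ddu (phi n)), (fun _ => 0), (fun _ => 0).
      split; [easy|split].
      { intros x Hx; split; [apply Dconst|split; [apply Dconst|]].
        apply cont_deriv with (fun _ => 0), Dconst. }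
      intros K Kc KI; destruct (Hcv K Kc KI) as [H1 [H2 H3]].
      split; [|split]; intros eps Heps.
      -- destruct (H1 eps Heps) as [N HN]; exists N; intros n Hn x Hx.
         rewrite <- (Hus x (KI x Hx)); auto.
      -- destruct (H2 eps Heps) as [N HN]; exists N; intros n Hn x Hx.
         rewrite <- (Hdus x (KI x Hx)); auto.
      -- destruct (H3 eps Heps) as [N HN]; exists N; intros n Hn x Hx.
         specialize (HN n Hn x Hx); rewrite (Hdus x (KI x Hx)) in HN.
         replace (- 0 / x - 0 * f (us x)) with 0 in HN by (unfold Rdiv; ring).
         exact HN.
    * assert (l0 : 0 < l) by (simpl in lams_ge0; lra).
      assert (Hdec : forall x y, 0 < x -> x <= y -> y <= 1 -> us y <= us x).
      { intros x y x0 xy y1.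
        apply (is_lim_seq_le (fun n => U (phi n) y) (fun n => U (phi n) x)
          (us y) (us x)); [|apply HU; lra|apply HU; lra].
        intros n; apply (radial_nonincreasing f (lam (phi n)) (U (phi n)) (V (phi n)));
          auto; lra. }
      exists l; split; [easy|split; [easy|]].
      exists us, dus, (fun r => - dus r / r - l * f (us r)).
      split; [easy|split; [easy|split]].
      { exists (fun n => du (phi n)), (fun n => ddu (phi n)), dus,
          (fun r => - dus r / r - l * f (us r)); auto. }
      split; [|split; [|split; [|split]]].
      -- intros r Hr; unfold Ioc01 in Hr; field; lra.
      -- intros r Hr; apply us0; lra.
      -- apply Rle_antisym; [|apply us0; lra].
         apply (is_lim_seq_le (fun n => U (phi n) 1) (fun _ => 0) (us 1) 0);
           [|apply HU; lra|apply is_lim_seq_const].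
         intros n; right; apply (HR (phi n)).
      -- apply (C2_on_integrable f l us dus); auto; lra.
      -- intros Hf0; apply (C2_on_positive f l us dus); auto.
  (* The whole sequence works here, with the identity as extraction. *)
  + split; [intros n; lia|]; right; right; split; [easy|].
    destruct (fast_growing_linear f Hg) as [K [T [K0 [T0 HKT]]]].
    intros D Dc DI; destruct (compact_Ioc01 D Dc DI) as [a [Ha HDa]].
    assert (ln0 : 0 < - ln a)
      by (assert (H := ln_increasing a 1); rewrite ln_1 in H; lra).
    assert (Hc : 0 < K * a ^ 2 / 4 * - ln a).
    { assert (0 < a ^ 2) by nra; apply Rmult_lt_0_compat; nra. }
    apply is_lim_seq_spec in lam_lim.
    (* Past N, lam exceeds the largest value that [radial_lam_le] allows when U n a > T. So U n a <=
       T for n >= N, and by monotonicity U n a bounds U n on [a,1]. *)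
    destruct (lam_lim (/ (K * a ^ 2 / 4 * - ln a))) as [N HN].
    destruct (eventually_bounded (fun n => U n a) N T) as [B HB].
    { intros n Hn; apply Rnot_lt_le; intros HT.
      assert (H := radial_lam_le f (lam n) (U n) (V n) K T a f0 (Hlam n) (HR n)
        K0 HKT Ha ltac:(lra) ltac:(lra)).
      specialize (HN n Hn); apply (Rmult_lt_compat_r _ _ _ Hc) in HN.
      rewrite Rinv_l in HN; lra. }
    exists B; intros n x Hx; assert (Hx' := HDa x Hx).
    rewrite <- (proj1 (HUu n x ltac:(lra))).
    rewrite Rabs_pos_eq by (apply (HR n); lra).
    apply Rle_trans with (2 := HB n).
    apply (radial_nonincreasing f (lam n) (U n) (V n)); auto; lra.
- intros Hinf phi Hphi [-> _].
  assert (HK : exists K, 0 < K /\ forall t, 0 < t -> K * t <= f t).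
  { destruct (Glb_Rbar_correct (fun y => exists t, 0 < t /\ y = f t / t)) as [Hlb _].
    fold f in Hinf.
    destruct (Glb_Rbar (fun y => exists t, 0 < t /\ y = f t / t)) as [g| |].
    - exists g; split; [exact Hinf|]; intros t Ht.
      assert (H : g <= f t / t) by (apply (Hlb (f t / t)); now exists t).
      apply (Rmult_le_compat_r t) in H; [|lra].
      unfold Rdiv in H; rewrite Rmult_assoc, Rinv_l, Rmult_1_r in H; lra.
    (* The infimum is not +infinity, because the quotient at t = 1 is a real number of the set. *)
    - exfalso; apply (Hlb (f 1 / 1)); exists 1; split; [lra|easy].
    - easy. }
  destruct HK as [K [K0 HK]].
  (* Any point of (0,1) would do. *)
  set (a := / 2); assert (Ha : 0 < a < 1) by (unfold a; lra).
  assert (ln0 : 0 < - ln a)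
    by (assert (H := ln_increasing a 1); rewrite ln_1 in H; lra).
  assert (Hc : 0 < K * a ^ 2 / 4 * - ln a).
  { assert (0 < a ^ 2) by nra; apply Rmult_lt_0_compat; nra. }
  apply is_lim_seq_spec in lam_lim.
  destruct (lam_lim (/ (K * a ^ 2 / 4 * - ln a))) as [n HN].
  specialize (HN n (Nat.le_refl n)).
  assert (HUa : 0 < U n a).
  { rewrite (proj1 (HUu n a ltac:(lra))).
    destruct (u_sol n) as [_ [_ [? [? [_ [_ [Hpos _]]]]]]]; auto. }
  (* Since K t <= f t for every t > 0, the threshold can be [U n a] itself; a single index with lam
     n large enough gives the contradiction. *)
  assert (H := radial_lam_le f (lam n) (U n) (V n) K (U n a) a f0 (Hlam n) (HR n)
    K0 ltac:(intros t Ht; apply HK; lra) Ha HUa (Rle_refl _)).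
  apply (Rmult_lt_compat_r _ _ _ Hc) in HN; rewrite Rinv_l in HN; lra.
Qed.
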